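(* Consider the $GL_4(\mathbb{C})$-orbits of cubic surfaces that have infinitely many singular points, and let $O$ be the highest-dimensional such orbit. Then every cubic surface in $O$ has rank six.
   Context: A cubic surface is a nonzero homogeneous polynomial $f$ of degree $3$ in four variables with complex coefficients, identified with its vanishing locus in $\mathbb{P}^3_{\mathbb{C}}$. The group $GL_4(\mathbb{C})$ acts by linear change of variables. A point $p\in\mathbb{P}^3$ is a singular point of $f$ if all partial derivatives of $f$ vanish at $p$. The rank of $f$ is the smallest $r$ such that $f=l_1^3+\cdots+l_r^3$ with $l_i$ complex linear forms. *)

(* Defs.v *)
From HB Require Import structures.
From mathcomp Require Import all_boot all_order all_algebra.
From mathcomp Require Import mpoly complex.
From mathcomp Require Import boolp classical_sets cardinality reals.

Set Implicit Arguments.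
Unset Strict Implicit.
Unset Printing Implicit Defensive.

Import GRing.Theory.
Local Open Scope ring_scope.
Local Open Scope classical_set_scope.

Section Dimension.
Variables (K : fieldType) (V : vectType K).

(* The polynomial function on V given by P in the coordinates of a fixed basis;
   the set of all such functions does not depend on the basis. *)
Definition polyfun (P : {mpoly K[\dim {:V}]}) (v : V) : K :=
  P.@[fun i => coord (vbasis {:V}) i v].

Definition alg_independent_on (S : set V) (d : nat)
    (phi : d.-tuple {mpoly K[\dim {:V}]}) : Prop :=
  forall Q : {mpoly K[d]},
    (forall v, S v -> Q.@[fun k => polyfun (tnth phi k) v] = 0) -> Q = 0.

(* Dimension of (the Zariski closure of) S: the transcendence degree over K of
   its ring of polynomial functions, that is, the maximal number of polynomial
   functions that are algebraically independent on S. Such a number never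
   exceeds \dim {:V}, so the range of the maximum is no restriction. *)
Definition variety_dim (S : set V) : nat :=
  (\max_(d < (\dim {:V}).+1 |
     `[< exists phi : d.-tuple {mpoly K[\dim {:V}]}, alg_independent_on S phi >]) d)%N.

End Dimension.

Notation cubic_form K := (dhomog 4 K 3).
Notation linear_form K := (dhomog 4 K 1).

Section CubicForms.
Variable K : fieldType.

Definition lin_subst (g : 'M[K]_4) : 4.-tuple {mpoly K[4]} :=
  [tuple \sum_(j < 4) g i j *: 'X_j | i < 4].

(* The orbit in the 20-dimensional vector space of cubic forms. It is stable
   under nonzero scalars when K is algebraically closed, so its dimension is
   one more than that of its image in the projective space of forms. *)
Definition GL4_orbit (f : cubic_form K) : set (cubic_form K) :=
  [set h | exists2 g : 'M[K]_4, g \in unitmx &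
     mpoly_of_dhomog h = mpoly_of_dhomog f \mPo lin_subst g].

(* Points of the projective space P^3 are the lines through the origin of K^4. *)
Definition singular_points (f : cubic_form K) : set {vspace 'rV[K]_4} :=
  [set p | \dim p = 1%N /\
     forall v : 'rV[K]_4, v \in p -> forall i : 'I_4,
       (mderiv i (mpoly_of_dhomog f)).@[fun j => v 0 j] = 0].

Definition infinitely_singular_orbit (O : set (cubic_form K)) : Prop :=
  exists f : cubic_form K,
    [/\ f != 0, infinite_set (singular_points f) & O = GL4_orbit f].

Definition highest_dim_infinitely_singular_orbit
    (O : set (cubic_form K)) : Prop :=
  infinitely_singular_orbit O /\
  forall O', infinitely_singular_orbit O' ->
    (variety_dim O' <= variety_dim O)%N.

Definition sum_of_cubes (f : cubic_form K) (r : nat) : Prop :=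
  exists l : 'I_r -> linear_form K,
    mpoly_of_dhomog f = \sum_(i < r) mpoly_of_dhomog (l i) ^+ 3.

Definition has_rank (f : cubic_form K) (r : nat) : Prop :=
  sum_of_cubes f r /\ forall s, sum_of_cubes f s -> (r <= s)%N.

End CubicForms.

(* Main.v *)
Require Import Defs.
From mathcomp Require Import all_boot all_order all_algebra.
From mathcomp Require Import mpoly complex.
From mathcomp Require Import boolp classical_sets cardinality reals.
From mathcomp Require Import finmap ring zify.

Set Implicit Arguments.
Unset Strict Implicit.
Unset Printing Implicit Defensive.

Import Order.TTheory GRing.Theory Num.Theory.
Local Open Scope ring_scope.

(** Let W = x^2 z + y^2 w, the general ruled cubic.  The theorem follows from
    two facts: the highest-dimensional orbit is that of W, and W has rank six.

    Geometry.  Write a cubic f through its symmetric tensor T of third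
    derivatives; a vector v is singular when T(v, v, .) = 0.  Infinitely many
    singular points give five of them.  If the first three are collinear, their
    equations force T(u, v, .) = 0 for all u and v on that line, so f lies in
    (l1, l2)^2, where l1 and l2 cut out the line.  Otherwise a linear relation
    among four or five of the points kills enough coefficients of T for f to
    vanish on the plane through three of them ([infinitely_singular_cases]).
    So f either contains a plane, or has the form l1^2 m1 + l1 l2 m2 + l2^2 m3.  In the second case the five linear forms are
    dependent, and completing a square turns f either into
    l1^2 m1 + l1 l2 m2 + e l2^3 (called pinched here: Cayley's ruled cubic and
    its degenerations) or into l1^2 m1 + l2^2 m2.  The latter is a linear
    transform of W if its four linear forms are independent, and is pinched
    otherwise ([has_double_line_cases], [two_squares_cases]).

    Dimensions.  Cubics containing a plane, and pinched cubics, are covered by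
    finitely many families with 13 parameters, so that orbits made of such
    cubics have dimension at most 13: more than 13 polynomials in 13 variables
    are algebraically dependent ([algebraic_dependence], by counting monomials).
    The tangent space at W of the orbit of W is spanned by 14 monomials, which
    makes the Jacobian of the corresponding 14 coefficients along the orbit
    diagonal and invertible; hence the orbit of W has dimension at least 14
    ([jacobian_criterion], [variety_dim_whitney]).  A highest orbit is thus the
    orbit of W.

    Rank.  Every l^2 m is a sum of three cubes, so W is a sum of six.
    Conversely let W be the sum of the cubes of s < 6 linear forms with
    coefficients (a_t, b_t, c_t, d_t).  As W depends on all four variables,
    these vectors span the space, so they satisfy at most one linear relation.
    But W is killed by the second derivatives zz, zw and ww, so (c_t^2),
    (c_t d_t) and (d_t^2) are all relations.  Being proportional, they force
    d = k c for some scalar k, and the coefficient of y^2 w in W would be k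
    times that of y^2 z, which is zero ([whitney_cubes_ge]). *)

(** * Derivations and polynomials *)

Lemma mderivXU (R : nzRingType) n (i j : 'I_n) :
  ('X_i : {mpoly R[n]})^`M(j) = (i == j)%:R.
Proof.
rewrite mderivX mnm1E; case: eqP => [<-|_]; last by rewrite scale0r.
rewrite scale1r -mpolyX0; congr 'X_[_].
by apply/mnmP => k; rewrite mnmBE mnm0E subnn.
Qed.

Lemma mderiv_natr (R : nzRingType) n (m : nat) (i : 'I_n) :
  (m%:R : {mpoly R[n]})^`M(i) = 0.
Proof. by rewrite -mpolyC_nat mderivC. Qed.

Lemma left_kernel_vector (K : fieldType) m n (A : 'M[K]_(m, n)) :
  (\rank A < m)%N -> exists2 u : 'rV[K]_m, u != 0 & u *m A = 0.
Proof.
move=> rkA; have kA : kermx A != 0.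
  by rewrite -mxrank_eq0 mxrank_ker subn_eq0 -ltnNge.
by case: (rowV0Pn kA) => u /sub_kermxP uA u0; exists u.
Qed.

(** An induction on the degree: if all derivatives of p vanish, then p is
    constant.  It serves both for polynomials that vanish at every point and
    for algebraic relations, since each class is stable under derivation. *)
Lemma mpoly_deriv_ind (K : numDomainType) n (P : {mpoly K[n]} -> Prop) :
  (forall p i, P p -> P p^`M(i)) -> (forall c, P c%:MP -> c = 0) ->
  forall p, P p -> p = 0.
Proof.
move=> Pd Pc p; have [k] := ubnP (msize p); elim: k p => // k IH p.
rewrite ltnS => szp Pp.
have dp0 i : p^`M(i) = 0.
  case: (eqVneq p^`M(i) 0) => // dp0; apply: IH (Pd _ i Pp).
  apply: leq_trans szp; rewrite -mlead_deg //.
  have := mlead_supp dp0; rewrite mcoeff_msupp mcoeff_deriv => lc.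
  have : (mlead p^`M(i) + U_(i))%MM \in msupp p.
    by rewrite mcoeff_msupp; apply: contra_neq lc => ->; rewrite mul0rn.
  by move/msize_mdeg_lt; rewrite mdegD mdeg1 addn1.
have pC : p = (p@_0)%:MP.
  apply/mpolyP => m; rewrite mcoeffC.
  case: (eqVneq m 0%MM) => [->|m0]; first by rewrite mulr1.
  rewrite mulr0.
  have [i mi] : exists i, m i != 0%N.
    apply/existsP; apply: contraNT m0; rewrite negb_exists => /forallP m0.
    by apply/eqP/mnmP => i; rewrite mnm0E; have := m0 i; rewrite negbK => /eqP.
  have /mpolyP/(_ (m - U_(i))%MM) := dp0 i.
  rewrite mcoeff_deriv submK ?lep1mP // mcoeff0 => /eqP.
  by rewrite mulrn_eq0 /= => /eqP.
by rewrite pC (Pc (p@_0)) ?mpolyC0 // -pC.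
Qed.

Section Derivation.
Variables (R S : comNzRingType) (n : nat).
Variables (f : {rmorphism R -> S}) (h : 'I_n -> S) (D : {additive S -> S}).
Hypothesis D_mul : forall x y, D (x * y) = D x * y + x * D y.
Hypothesis D_const : forall c, D (f c) = 0.

(** A derivation along a ring morphism is determined by its values on the
    variables.  Taking for D a partial derivative, or the derivative of
    univariate polynomials, gives two chain rules at once. *)
Lemma derivation_mmap (p : {mpoly R[n]}) :
  D (mmap f h p) = \sum_i mmap f h p^`M(i) * D (h i).
Proof.
pose P (p : {mpoly R[n]}) :=
  D (mmap f h p) = \sum_i mmap f h p^`M(i) * D (h i).
have PC c : P c%:MP.
  rewrite /P mmapC D_const big1 // => i _.
  by rewrite mderivC mmap0 mul0r.
have PD p1 p2 : P p1 -> P p2 -> P (p1 + p2).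
  rewrite /P rmorphD raddfD /= => -> ->; rewrite -big_split /=.
  by apply: eq_bigr => i _; rewrite mderivD rmorphD mulrDl.
have PM p1 p2 : P p1 -> P p2 -> P (p1 * p2).
  rewrite /P rmorphM /= D_mul => -> ->; rewrite mulr_suml mulr_sumr.
  rewrite -big_split /=; apply: eq_bigr => i _.
  by rewrite mderivM rmorphD !rmorphM /=; ring.
have PX i : P 'X_i.
  rewrite /P mmapX mmap1U (bigD1 i) //= big1 => [|j ji]; last first.
    by rewrite mderivX mnm1E eq_sym (negbTE ji) scale0r mmap0 mul0r.
  rewrite mderivX mnm1E eqxx scale1r.
  have -> : (U_(i) - U_(i) = 0 :> 'X_{1..n})%MM.
    by apply/mnmP => j; rewrite mnmBE mnm0E subnn.
  by rewrite mpolyX0 rmorph1 mul1r addr0.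
rewrite -/(P p) (mpolyE p); apply: (big_ind P _ PD) => [|m _].
  by rewrite -mpolyC0.
rewrite -mul_mpolyC; apply: (PM _ _ (PC _)).
rewrite mpolyXE_id; apply: (big_ind P _ PM) => [|i _].
  by rewrite -mpolyC1.
elim: (m i) => [|k IH]; first by rewrite expr0 -mpolyC1.
by rewrite exprS; apply: (PM _ _ (PX _)).
Qed.

End Derivation.

Lemma mderiv_comp (R : comNzRingType) n k (p : {mpoly R[n]})
    (t : n.-tuple {mpoly R[k]}) i :
  (p \mPo t)^`M(i) = \sum_j (p^`M(j) \mPo t) * (tnth t j)^`M(i).
Proof.
have DM (x y : {mpoly R[k]}) : (x * y)^`M(i) = x^`M(i) * y + x * y^`M(i).
  exact: mderivM.
exact: (derivation_mmap (f := @mpolyC k R) (tnth t) DM (mderivC i)).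
Qed.

Lemma horner_mmap_polyC (R : comNzRingType) n (h : 'I_n -> {poly R})
    (p : {mpoly R[n]}) s :
  (mmap (@polyC R) h p).[s] = p.@[fun j => (h j).[s]].
Proof.
rewrite /meval /mmap horner_sum; apply: eq_bigr => m _.
rewrite hornerM hornerC /mmap1 horner_prod.
by congr (_ * _); apply: eq_bigr => j _; rewrite horner_exp.
Qed.

Lemma poly_horner0 (K : numDomainType) (p : {poly K}) :
  (forall s, p.[s] = 0) -> p = 0.
Proof.
move=> p0; apply: (@roots_geq_poly_eq0 _ _ [seq i%:R | i <- iota 0 (size p)]).
- by apply/allP => s _; rewrite rootE p0.
- by rewrite map_inj_uniq ?iota_uniq //; apply: (mulrIn (oner_neq0 _)).
- by rewrite size_map size_iota.
Qed.

(** Restricting p to a line in the i-th direction gives a univariate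
    polynomial with infinitely many roots, so the i-th derivative vanishes
    everywhere as well. *)
Lemma mpoly_meval0 (K : numDomainType) n (p : {mpoly K[n]}) :
  (forall v, p.@[v] = 0) -> p = 0.
Proof.
apply: (mpoly_deriv_ind (P := fun p => forall v, p.@[v] = 0)) => {p}; last first.
  by move=> c /(_ (fun=> 0)); rewrite mevalC.
move=> p i p0 v.
(* the restriction of p to the line through v in the i-th direction *)
pose h j : {poly K} := (v j)%:P + (i == j)%:R%:P * 'X.
have P0 : mmap (@polyC K) h p = 0.
  by apply: poly_horner0 => s; rewrite horner_mmap_polyC p0.
have /(congr1 (fun q : {poly K} => q.[0])) :
    deriv (mmap (@polyC K) h p) = 0 by rewrite P0 linear0.
have DM (x y : {poly K}) : deriv (x * y) = deriv x * y + x * deriv y.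
  exact: derivM.
rewrite (derivation_mmap (f := @polyC K) h DM (@derivC K)) horner0.
rewrite horner_sum (bigD1 i) //= big1 => [|j ji].
  rewrite hornerM horner_mmap_polyC /h eqxx derivD derivC add0r mul1r derivX hornerC.
    rewrite mulr1 addr0 => <-.
    by apply: meval_eq => j; rewrite !hornerE.
by rewrite /h eq_sym (negbTE ji) mul0r addr0 derivC mulr0 horner0.
Qed.

(** By the chain rule, the Jacobian matrix sends the vector of the partial
    derivatives of Q, evaluated along phi, to the gradient of Q o phi = 0.  Its
    determinant is a nonzero polynomial, so these partial derivatives satisfy
    the same relation as Q. *)
Lemma jacobian_criterion (K : numDomainType) n
    (phi : n.-tuple {mpoly K[n]}) (v : 'I_n -> K) (Q : {mpoly K[n]}) :
  \det (\matrix_(i, j) ((tnth phi j)^`M(i)).@[v]) != 0 ->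
  Q \mPo phi = 0 -> Q = 0.
Proof.
move=> detJv; pose J := \matrix_(i, j) (tnth phi j)^`M(i).
have detJ : \det J != 0.
  apply: contra_neq detJv => detJ0.
  have -> : \matrix_(i, j) ((tnth phi j)^`M(i)).@[v] = map_mx (meval v) J.
    by apply/matrixP => i j; rewrite !mxE.
  by rewrite det_map_mx detJ0 rmorph0.
move: Q; apply: mpoly_deriv_ind => [Q k Q0|c]; last first.
  by rewrite comp_mpolyC => /eqP; rewrite mpolyC_eq0 => /eqP.
pose g := \col_j (Q^`M(j) \mPo phi).
have Jg : J *m g = 0.
  apply/matrixP => i j; rewrite !mxE.
  transitivity ((Q \mPo phi)^`M(i)); last by rewrite Q0 mderiv0.
  by rewrite mderiv_comp; apply: eq_bigr => l _; rewrite !mxE mulrC.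
have : \adj J *m (J *m g) = 0 by rewrite Jg mulmx0.
rewrite mulmxA mul_adj_mx mul_scalar_mx => /matrixP/(_ k 0).
by rewrite !mxE => /eqP; rewrite mulf_eq0 (negbTE detJ) => /eqP.
Qed.

(** * Algebraic dependence *)

Definition mnm_of_ffun d N (a : {ffun 'I_d -> 'I_N}) : 'X_{1..d} :=
  [multinom (a i : nat) | i < d].

Lemma mnm_of_ffun_inj d N : injective (@mnm_of_ffun d N).
Proof.
move=> a b /mnmP ab; apply/ffunP => i; apply: val_inj.
by have := ab i; rewrite !mnmE.
Qed.

Lemma msize_prod_le (R : idomainType) n (I : finType) (F : I -> {mpoly R[n]}) B :
  (forall i, msize (F i) <= (B i).+1)%N ->
  (msize (\prod_i F i) <= (\sum_i B i).+1)%N.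
Proof.
move=> FB; apply: (big_ind2 (fun p b => msize p <= b.+1)%N) => //.
  by rewrite msize1.
move=> p b q c pb qc.
case: (eqVneq p 0) => [->|p0]; first by rewrite mul0r msize0.
case: (eqVneq q 0) => [->|q0]; first by rewrite mulr0 msize0.
by rewrite msizeM //; move: (msize p) (msize q) pb qc => k l; lia.
Qed.

Lemma msizeX_le (R : idomainType) n (p : {mpoly R[n]}) e k :
  (msize p <= e.+1)%N -> (msize (p ^+ k) <= (k * e).+1)%N.
Proof.
move=> pe; rewrite -(card_ord k) -prodr_const -sum_nat_const.
exact: msize_prod_le.
Qed.

(** Counting.  Consider the products of powers of the p_i with all exponents
    less than N.  There are N ^ d of them, and they live in a space of
    polynomials of dimension at most (d N e + 1) ^ m, where e bounds the degrees
    of the p_i.  Since m < d, the first number is larger for N large, so there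
    is a linear relation between the products. *)
Lemma algebraic_dependence (K : fieldType) m d (p : d.-tuple {mpoly K[m]}) :
  (m < d)%N -> exists2 Q : {mpoly K[d]}, Q != 0 & Q \mPo p = 0.
Proof.
move=> md.
pose e := (\max_i msize (tnth p i))%N.
pose N := ((d * e).+1 ^ m).+1; pose M := (d * (N * e)).+1.
pose A := {ffun 'I_d -> 'I_N}; pose B := {ffun 'I_m -> 'I_M}.
(* M <= N (d e + 1), hence M ^ m < N ^ (m + 1) by the choice of N *)
have ltBA : (#|B| < #|A|)%N.
  rewrite !card_ffun !card_ord.
  have leMN : (M ^ m <= (N * (d * e).+1) ^ m)%N.
    have leM : (M <= N * (d * e).+1)%N.
      by rewrite /M mulnCA (mulnS N) -[leqLHS]add1n leq_add2r.
    by case: (posnP m) => [->|m0]; rewrite ?expn0 ?leq_exp2r.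
  apply: leq_ltn_trans leMN _; rewrite expnMn.
  apply: (@leq_trans (N ^ m.+1)); last first.
    by rewrite leq_exp2l // /N ltnS expn_gt0.
  by rewrite expnSr ltn_pmul2l ?expn_gt0.
pose term (a : A) := \prod_i (tnth p i) ^+ (a i).
have [u u0 uA] : exists2 u : 'rV[K]_#|A|, u != 0 & u *m
    (\matrix_(a < #|A|, b < #|B|)
      (term (enum_val a))@_(mnm_of_ffun (enum_val b))) = 0.
  by apply: left_kernel_vector; apply: leq_ltn_trans (rank_leq_col _) ltBA.
have size_term a : (msize (term a) <= M)%N.
  have pe i : (msize (tnth p i) <= e.+1)%N.
    by apply: leqW; apply: (leq_bigmax i).
  apply: leq_trans (msize_prod_le (fun i => msizeX_le (a i) (pe i))) _.
  rewrite ltnS -[X in (X * _)%N]card_ord -sum_nat_const leq_sum // => i _.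
  by rewrite leq_mul2r ltnW ?orbT.
exists (\sum_(a : A) u 0 (enum_rank a) *: 'X_[mnm_of_ffun a]).
  apply: contra_neq u0 => Q0; apply/rowP => i; rewrite mxE.
  have /mpolyP/(_ (mnm_of_ffun (enum_val i))) := Q0.
  rewrite mcoeff0 raddf_sum (bigD1 (enum_val i)) //= big1 => [|a ai].
    by rewrite mcoeffZ mcoeffX eqxx mulr1 addr0 enum_valK.
  by rewrite mcoeffZ mcoeffX (inj_eq (@mnm_of_ffun_inj _ _)) (negbTE ai) mulr0.
rewrite raddf_sum /=; apply/mpolyP => b; rewrite mcoeff0 raddf_sum /=.
have coefE a : ((u 0 (enum_rank a) *: 'X_[mnm_of_ffun a]) \mPo p)@_b =
    u 0 (enum_rank a) * (term a)@_b.
  rewrite comp_mpolyZ mcoeffZ comp_mpolyX; congr (_ * _@__).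
  by apply: eq_bigr => i _; rewrite mnmE.
have [leMb|ltbM] := leqP M (mdeg b).
  rewrite big1 // => a _; rewrite coefE.
  rewrite [(term a)@_b]memN_msupp_eq0 ?mulr0 //.
  exact: msize_mdeg_ge (leq_trans (size_term a) leMb).
have ltb i : (b i < M)%N.
  by apply: leq_ltn_trans ltbM; rewrite mdegE (bigD1 i) //= leq_addr.
pose b' : B := [ffun i => Ordinal (ltb i)].
have b'E : mnm_of_ffun b' = b by apply/mnmP => i; rewrite mnmE ffunE.
have /rowP/(_ (enum_rank b')) := uA; rewrite !mxE => uAb.
rewrite -[RHS]uAb (reindex_onto enum_val enum_rank) => [|a _]; last by rewrite enum_rankK.
apply: eq_big => [a|a _]; first by rewrite enum_valK eqxx.
by rewrite coefE !mxE !enum_rankK !enum_valK b'E.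
Qed.

(** * Dimension of sets of cubic forms *)

Section VarietyDim.
Variables (K : fieldType) (V : vectType K).

(** The bound d <= \dim V built into variety_dim is automatic: functions on V are
    polynomials in \dim V coordinates. *)
Lemma leq_variety_dim (S : set V) d (phi : d.-tuple {mpoly K[\dim {:V}]}) :
  alg_independent_on S phi -> (d <= variety_dim S)%N.
Proof.
move=> phiS.
have ltd : (d < (\dim {:V}).+1)%N.
  rewrite ltnNge; apply/negP => /(algebraic_dependence phi)[Q Q0 Qphi].
  case/negP: Q0; apply/eqP; apply: phiS => v _.
  by rewrite /polyfun -comp_mpoly_meval Qphi meval0.
rewrite /variety_dim.
apply: (@leq_bigmax_cond _ _ (fun d : 'I_(\dim {:V}).+1 => d : nat) (Ordinal ltd)).
by apply/asboolP; exists phi.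
Qed.

(** A union of finitely many images of affine m-space has dimension at most m:
    on each image m + 1 functions satisfy a relation, and the product of these
    relations holds on the union. *)
Lemma variety_dim_leq (S : set V) (I : finType) m
    (psi : I -> 'I_(\dim {:V}) -> {mpoly K[m]}) :
  (forall v, S v -> exists i t, forall j, coord (vbasis {:V}) j v = (psi i j).@[t]) ->
  (variety_dim S <= m)%N.
Proof.
move=> Spsi; apply/bigmax_leqP => d /asboolP[phi phiS].
rewrite leqNgt; apply/negP => ltmd.
pose p i : d.-tuple {mpoly K[m]} :=
  [tuple tnth phi k \mPo [tuple psi i j | j < \dim {:V}] | k < d].
have /(_ _)/cid2-/all_sig2[Q Q0 Qp] i := algebraic_dependence (p i) ltmd.
suff /eqP : \prod_i Q i = 0 by apply/negP/prodf_neq0.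
apply: phiS => v /Spsi[i [t vE]].
rewrite (bigD1 i) //= mevalM [X in X * _](_ : _ = 0) ?mul0r //.
rewrite -[RHS](meval0 t) -(Qp i) comp_mpoly_meval.
apply: meval_eq => k; rewrite tnth_mktuple comp_mpoly_meval.
by apply: meval_eq => j; rewrite tnth_mktuple vE.
Qed.

Lemma linear_polyfun (L : V -> K) :
  (forall c u v, L (c *: u + v) = c * L u + L v) ->
  exists P, forall v, polyfun P v = L v.
Proof.
move=> L_lin; have LD u v : L (u + v) = L u + L v.
  by rewrite -[u]scale1r L_lin mul1r scale1r.
have L0 : L 0 = 0 by apply: (addrI (L 0)); rewrite -LD !addr0.
have LZ c u : L (c *: u) = c * L u by rewrite -[c *: u]addr0 L_lin L0 addr0.
exists (\sum_(j < \dim {:V}) L (vbasis {:V})`_j *: 'X_j) => v.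
rewrite /polyfun raddf_sum /= [in RHS](coord_vbasis (memvf v)).
rewrite (big_morph L LD L0); apply: eq_bigr => j _.
by rewrite mevalZ mevalXU LZ mulrC.
Qed.

End VarietyDim.

(** The families are written as generic cubics H i, with coefficients that are
    polynomials in the parameters. *)
Lemma variety_dim_cubic_family (K : fieldType) (S : set (cubic_form K))
    (I : finType) m (H : I -> {mpoly {mpoly K[m]}[4]}) :
  (forall h, S h -> exists i t, mpoly_of_dhomog h = map_mpoly (meval t) (H i)) ->
  (variety_dim S <= m)%N.
Proof.
move=> SH.
pose e (b : 'X_{1..4 < 4}) : cubic_form K := @indhomog 4 K 3 'X_[b].
pose psi i j : {mpoly K[m]} :=
  \sum_(b : 'X_{1..4 < 4}) coord (vbasis {:cubic_form K}) j (e b) *: (H i)@_b.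
apply: (variety_dim_leq (psi := psi)) => h /SH[i [t hE]]; exists i, t => j.
have -> : h = \sum_(b : 'X_{1..4 < 4}) (mpoly_of_dhomog h)@_b *: e b.
  apply: val_inj; rewrite /= raddf_sum /= [LHS](@mpolywE _ _ 4).
    apply: eq_bigr => b _.
    have [b3|b3] := eqVneq (mdeg b) 3.
      congr (_ *: _); apply/esym/insubdK; rewrite -topredE /= dhomogX; exact/eqP.
    by rewrite [_@__](dhomog_nemf_coeff (dhomog_is_dhomog h) b3) !scale0r.
  rewrite msizeE; apply/bigmax_leqP_seq => b bh _.
  by rewrite (dhomog_mf (dhomog_is_dhomog h) bh).
rewrite linear_sum raddf_sum /=; apply: eq_bigr => b _.
by rewrite linearZ /= mevalZ hE mcoeff_map_mpoly mulrC.
Qed.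

(** * Linear forms and linear substitutions *)

Lemma linear_formE (R : nzRingType) n (l : {mpoly R[n]}) :
  l \is 1.-homog -> l = \sum_j l@_U_(j) *: 'X_j.
Proof.
move=> l1; apply/mpolyP => m; rewrite raddf_sum /=.
have [/eqP/mdeg1P[i /eqP ->]|m1] := eqVneq (mdeg m) 1%N.
  rewrite (bigD1 i) //= big1 => [|j ji]; rewrite mcoeffZ mcoeffXU.
    by rewrite eqxx mulr1 addr0.
  by rewrite (negbTE ji) mulr0.
rewrite (dhomog_nemf_coeff l1 m1) big1 // => j _; rewrite mcoeffZ mcoeffX.
have [jm|_] := eqVneq U_(j)%MM m; last by rewrite mulr0.
by move: m1; rewrite -jm mdeg1.
Qed.

Lemma linear_forms_dependent (K : fieldType) k n (l : 'I_k -> {mpoly K[n]}) :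
  (forall i, l i \is 1.-homog) ->
  (\rank (\matrix_(i, j) (l i)@_U_(j)) < k)%N ->
  exists2 u : 'I_k -> K, (exists i, u i != 0) & \sum_i u i *: l i = 0.
Proof.
move=> l1 /left_kernel_vector[u /rV0Pn u0 ul]; exists (u 0) => //.
under eq_bigr => i _ do rewrite [l i]linear_formE // scaler_sumr.
rewrite exchange_big big1 //= => j _.
under eq_bigr => i _ do rewrite scalerA.
rewrite -scaler_suml; have /rowP/(_ j) := ul; rewrite !mxE => ulj.
rewrite [X in X *: _](_ : _ = 0) ?scale0r // -[RHS]ulj.
by apply: eq_bigr => i _; rewrite mxE.
Qed.

Lemma mderiv_linear (R : nzRingType) n (l : {mpoly R[n]}) k :
  l \is 1.-homog -> l^`M(k) = (l@_U_(k))%:MP.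
Proof.
move=> l1; rewrite [in LHS](linear_formE l1) raddf_sum (bigD1 k) //= big1 => [|j jk].
  by rewrite mderivZ mderivXU eqxx addr0 -mul_mpolyC mulr1.
by rewrite mderivZ mderivXU (negbTE jk) scaler0.
Qed.

Lemma dhomog_sqrM (R : idomainType) n (l m : {mpoly R[n]}) :
  l \is 1.-homog -> m \is 1.-homog -> l ^+ 2 * m \is 3.-homog.
Proof. by move=> l1 m1; apply: (@dhomogM _ _ _ 2 _ 1) => //; apply: (dhomogMn 2 l1). Qed.

Lemma lin_subst_homog (K : fieldType) (g : 'M[K]_4) i :
  tnth (lin_subst g) i \is 1.-homog.
Proof.
rewrite tnth_mktuple; apply: rpred_sum => j _.
by rewrite rpredZ // dhomogX; apply/eqP/mdeg1.
Qed.

Lemma dhomog_lin_subst (K : fieldType) d (p : {mpoly K[4]}) (g : 'M[K]_4) :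
  p \is d.-homog -> p \mPo lin_subst g \is d.-homog.
Proof.
move=> pd; rewrite comp_mpolyE big_seq; apply: rpred_sum => m mp.
apply: rpredZ; rewrite -(dhomog_mf pd mp) /= mdegE.
apply: (big_ind2 (fun (q : {mpoly K[4]}) e => q \is e.-homog)).
- exact: dhomog1.
- by move=> q e r f; apply: dhomogM.
by move=> i _; have := dhomogMn (m i) (lin_subst_homog g i); rewrite mul1n.
Qed.

Lemma dhomog_mderiv (R : nzRingType) n d (p : {mpoly R[n]}) i :
  p \is d.+1.-homog -> p^`M(i) \is d.-homog.
Proof.
move=> pd; apply/dhomogP => m; rewrite mcoeff_msupp mcoeff_deriv => pm.
have : (m + U_(i))%MM \in msupp p.
  by rewrite mcoeff_msupp; apply: contra_neq pm => ->; rewrite mul0rn.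
by move/(dhomog_mf pd); rewrite /= mdegD mdeg1 addn1 => -[].
Qed.

Lemma dhomog_euler (R : comNzRingType) n d (p : {mpoly R[n]}) :
  p \is d.-homog -> \sum_i 'X_i * p^`M(i) = p *+ d.
Proof.
move=> pd; rewrite [in RHS](mpolyE p) [in RHS]big_seq -[RHS]sumrMnl.
transitivity (\sum_i \sum_(m <- msupp p | m \in msupp p)
    ('X_i * (p@_m *: 'X_[m])^`M(i))).
  apply: eq_bigr => i _.
  by rewrite [in LHS](mpolyE p) [in LHS]big_seq raddf_sum mulr_sumr.
rewrite exchange_big /=; apply: eq_bigr => m mp.
transitivity (\sum_i (p@_m *: 'X_[m]) *+ m i).
  apply: eq_bigr => i _; rewrite mderivZ mderivX scaler_nat -scalerAr mulrnAr.
  rewrite scalerMnr; case: (posnP (m i)) => [->|mi]; first by rewrite !mulr0n.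
  by rewrite -mpolyXD addmC submK // lep1mP -lt0n.
by rewrite sumrMnr -(dhomog_mf pd mp) /= mdegE.
Qed.
Definition i0 : 'I_4 := @Ordinal 4 0 isT.
Definition i1 : 'I_4 := @Ordinal 4 1 isT.
Definition i2 : 'I_4 := @Ordinal 4 2 isT.
Definition i3 : 'I_4 := @Ordinal 4 3 isT.

Lemma sum4 (M : nmodType) (F : 'I_4 -> M) :
  \sum_i F i = F i0 + F i1 + F i2 + F i3.
Proof.
rewrite !big_ord_recr big_ord0 /= add0r.
by congr (_ + _ + _ + _); congr F; apply: val_inj.
Qed.

Lemma ord4P (P : 'I_4 -> Prop) : P i0 -> P i1 -> P i2 -> P i3 -> forall i, P i.
Proof.
move=> P0 P1 P2 P3 [[|[|[|[|//]]]] lt_i];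
  by [rewrite (_ : Ordinal _ = i0) //; apply: val_inj
     |rewrite (_ : Ordinal _ = i1) //; apply: val_inj
     |rewrite (_ : Ordinal _ = i2) //; apply: val_inj
     |rewrite (_ : Ordinal _ = i3) //; apply: val_inj].
Qed.

(** Allows an argument about two distinct coordinates to treat all pairs at once. *)
Lemma ord4_split (i j : 'I_4) : i != j -> exists k l : 'I_4,
  [/\ uniq [:: i; j; k; l], forall a, a \in [:: i; j; k; l] &
      forall (M : nmodType) (F : 'I_4 -> M), \sum_a F a = F i + F j + F k + F l].
Proof.
move=> ij; have : #|~: [set i; j]| == 2%N.
  by have := cardsC [set i; j]; rewrite cards2 ij card_ord; lia.
case/cards2P => k [l [kl kE]]; exists k, l.
have memC a : (a \notin [set i; j]) = (a \in [set k; l]) by rewrite -kE !inE.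
have ijkl : uniq [:: i; j; k; l].
  have : k \in ~: [set i; j] by rewrite kE set21.
  have : l \in ~: [set i; j] by rewrite kE set22.
  rewrite !inE !negb_or => /andP[li lj] /andP[ki kj].
  rewrite /= !inE !negb_or ij kl ![i == _]eq_sym ![j == _]eq_sym.
  by rewrite li lj ki kj.
have cover a : a \in [:: i; j; k; l].
  have := memC a; rewrite !inE; case: (a == i) => //; case: (a == j) => //=.
split=> [|a|M F]; [exact: ijkl|exact: cover|].
rewrite (eq_bigl (mem [:: i; j; k; l])); last by move=> a; rewrite /= cover.
by rewrite -big_uniq //= !big_cons big_nil addr0 !addrA.
Qed.

Section LinearSubstitution.
Variable K : fieldType.

Lemma mderiv_lin_subst (g : 'M[K]_4) i k :
  (tnth (lin_subst g) i)^`M(k) = (g i k)%:MP.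
Proof.
rewrite tnth_mktuple linear_sum (bigD1 k) //= big1 => [|j jk].
  by rewrite mderivZ mderivXU eqxx addr0 -mul_mpolyC mulr1.
by rewrite mderivZ mderivXU (negbTE jk) scaler0.
Qed.

Lemma mderiv_comp_lin_subst (h : {mpoly K[4]}) (g : 'M[K]_4) i :
  (h \mPo lin_subst g)^`M(i) = \sum_a g a i *: (h^`M(a) \mPo lin_subst g).
Proof.
rewrite mderiv_comp; apply: eq_bigr => a _.
by rewrite mderiv_lin_subst mulrC mul_mpolyC.
Qed.

Lemma lin_subst_comp (f : {mpoly K[4]}) (g h : 'M[K]_4) :
  (f \mPo lin_subst g) \mPo lin_subst h = f \mPo lin_subst (g *m h).
Proof.
rewrite [f \mPo lin_subst g]comp_mpolyEX [RHS]comp_mpolyEX raddf_sum /=; apply: eq_bigr => m _.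
rewrite !comp_mpolyZ !comp_mpolyX rmorph_prod; congr (_ *: _).
apply: eq_bigr => i _; rewrite rmorphXn /=; congr (_ ^+ _).
rewrite !tnth_mktuple raddf_sum /=.
under eq_bigr => j _ do rewrite comp_mpolyZ comp_mpolyXU -tnth_nth tnth_mktuple scaler_sumr.
rewrite exchange_big; apply: eq_bigr => k _ /=.
rewrite mxE scaler_suml; apply: eq_bigr => j _.
by rewrite scalerA.
Qed.

Lemma lin_subst1 (f : {mpoly K[4]}) : f \mPo lin_subst 1%:M = f.
Proof.
rewrite -[RHS]comp_mpoly_id; congr (_ \mPo _); apply: eq_from_tnth => i.
rewrite !tnth_mktuple (bigD1 i) //= mxE eqxx scale1r big1 ?addr0 // => j ji.
by rewrite mxE eq_sym (negbTE ji) scale0r.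
Qed.

End LinearSubstitution.

(** The third derivatives of a cubic form are constants; evaluating them at 0
    turns them into scalars.  They form six times its polarization. *)
Definition polar (R : nzRingType) n (h : {mpoly R[n]}) i j k : R :=
  (h^`M(i)^`M(j)^`M(k)).@[fun=> 0].

(** * The general ruled cubic and the dimension of its orbit *)

Section Whitney.
Variable K : numFieldType.

Definition whitney : {mpoly K[4]} := 'X_i0 ^+ 2 * 'X_i2 + 'X_i1 ^+ 2 * 'X_i3.

(** The value of polar on whitney composed with the substitution g, over any
    ring, so that g can also be a generic matrix. *)
Definition whitney_polar (A : comNzRingType) (g : 'M[A]_4) (i j k : 'I_4) : A :=
  (g i0 i * g i0 j * g i2 k + g i0 i * g i2 j * g i0 k + g i2 i * g i0 j * g i0 k +
   (g i1 i * g i1 j * g i3 k + g i1 i * g i3 j * g i1 k + g i3 i * g i1 j * g i1 k))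
  *+ 2.

Lemma whitney_lin_subst (g : 'M[K]_4) : whitney \mPo lin_subst g =
  tnth (lin_subst g) i0 ^+ 2 * tnth (lin_subst g) i2 +
  tnth (lin_subst g) i1 ^+ 2 * tnth (lin_subst g) i3.
Proof. by rewrite /whitney !(rmorphD, rmorphM, rmorphXn) /= !comp_mpolyXU -!tnth_nth. Qed.

Lemma polar_whitney (g : 'M[K]_4) i j k :
  polar (whitney \mPo lin_subst g) i j k = whitney_polar g i j k.
Proof.
have l0 a : (tnth (lin_subst g) a).@[fun=> 0] = 0.
  rewrite tnth_mktuple raddf_sum big1 // => b _ /=.
  by rewrite mevalZ mevalXU mulr0.
rewrite /polar whitney_lin_subst !expr2.
rewrite !(mderivD, mderivM, mderiv_lin_subst, mderivC).
rewrite !(mevalD, mevalM, mevalC, l0, meval0) /whitney_polar.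
ring.
Qed.

(** The entry (a, b) of a matrix stands for the infinitesimal substitution that
    adds to the a-th variable a multiple of the b-th, and which moves whitney
    along (d whitney / d x_a) x_b.  The entries (0, 0) and (1, 1) are left out,
    as they give the same monomials as (2, 2) and (3, 3). *)
Definition tangent_dir : seq (nat * nat) :=
  [:: (2, 0); (2, 1); (2, 2); (2, 3); (3, 0); (3, 1); (3, 2); (3, 3);
      (0, 1); (0, 2); (0, 3); (1, 0); (1, 2); (1, 3)]%N.

(** The monomial along which the direction at the same place in tangent_dir
    moves whitney, given by the indices of its three variables. *)
Definition tangent_monomial : seq ('I_4 * 'I_4 * 'I_4) :=
  [:: (i0, i0, i0); (i0, i0, i1); (i0, i0, i2); (i0, i0, i3);
      (i1, i1, i0); (i1, i1, i1); (i1, i1, i2); (i1, i1, i3);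
      (i0, i2, i1); (i0, i2, i2); (i0, i2, i3);
      (i1, i3, i0); (i1, i3, i2); (i1, i3, i3)].

(** The identity matrix perturbed in the 14 directions, so that the origin of
    the parameter space corresponds to the identity. *)
Definition slice_mx : 'M[{mpoly K[14]}]_4 :=
  \matrix_(a, b) ((a == b)%:R +
    \sum_(p < 14) (nth (0, 0)%N tangent_dir p == (a : nat, b : nat))%:R *: 'X_p).

Definition slice_coord : 14.-tuple {mpoly K[14]} :=
  [tuple let: (i, j, k) := nth (i0, i0, i0) tangent_monomial q in
         whitney_polar slice_mx i j k | q < 14].

(** The Jacobian of slice_coord at the origin, as computable natural numbers:
    d and e are the entries of the derivative of slice_mx and of its value. *)
Definition slice_jacobian (p q : nat) : nat :=
  let: (i, j, k) := nth (i0, i0, i0) tangent_monomial q in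
  let d (x y : 'I_4) := (nth (0, 0)%N tangent_dir p == (x : nat, y : nat)) : nat in
  let e (x y : 'I_4) := ((x : nat) == y) : nat in
  let t (x y z : 'I_4) := (d x i * e y j * e z k + e x i * d y j * e z k
                          + e x i * e y j * d z k)%N in
  (2 * (t i0 i0 i2 + t i0 i2 i0 + t i2 i0 i0 + (t i1 i1 i3 + t i1 i3 i1 + t i3 i1 i1)))%N.

Lemma slice_jacobian_diag (p q : 'I_14) : (slice_jacobian p q == 0%N) = (p != q).
Proof.
have : all (fun a => all (fun b => (slice_jacobian a b == 0%N) == (a != b)) (iota 0 14))
  (iota 0 14) by vm_compute.
move/allP/(_ p); rewrite mem_iota ltn_ord => /(_ isT)/allP/(_ q).
by rewrite mem_iota ltn_ord => /(_ isT)/eqP.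
Qed.

Lemma mderiv_slice_mx p a b : (slice_mx a b)^`M(p) =
  (nth (0, 0)%N tangent_dir p == (a : nat, b : nat))%:R.
Proof.
rewrite mxE mderivD mderiv_natr add0r raddf_sum (bigD1 p) //= big1 => [|q qp].
  by rewrite mderivZ mderivXU eqxx addr0 scaler_nat.
by rewrite mderivZ mderivXU (negbTE qp) scaler0.
Qed.

Lemma slice_mx0 a b : (slice_mx a b).@[fun=> 0] = (a == b)%:R.
Proof.
rewrite mxE mevalD rmorph_nat raddf_sum big1 ?addr0 // => p _ /=.
by rewrite mevalZ mevalXU mulr0.
Qed.

Lemma slice_coord_jacobian p q :
  ((tnth slice_coord q)^`M(p)).@[fun=> 0] = (slice_jacobian p q)%:R.
Proof.
rewrite tnth_mktuple /slice_jacobian.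
case: (nth _ tangent_monomial q) => [[i j] k]; rewrite /whitney_polar.
rewrite !(mderivD, mderivM, mderivMn, mderiv_slice_mx).
rewrite !(mevalD, mevalM, mevalMn, slice_mx0, rmorph_nat).
rewrite !(natrM, natrD) -!(inj_eq val_inj) /=.
ring.
Qed.

Lemma whitney_subst_homog g : whitney \mPo lin_subst g \is 3.-homog.
Proof. by rewrite whitney_lin_subst rpredD ?dhomog_sqrM ?lin_subst_homog. Qed.

(** An algebraic relation on the orbit between the 14 coordinates gives, after
    multiplication by the determinant of slice_mx, a polynomial in the
    parameters that vanishes everywhere; the Jacobian criterion then applies. *)
Lemma variety_dim_whitney (f : cubic_form K) :
  mpoly_of_dhomog f = whitney -> (14 <= variety_dim (GL4_orbit f))%N.
Proof.
move=> fE.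
pose L (q : 'I_14) : cubic_form K -> K := fun h =>
  let: (i, j, k) := nth (i0, i0, i0) tangent_monomial q in
  polar (mpoly_of_dhomog h) i j k.
have L_lin q c u v : L q (c *: u + v) = c * L q u + L q v.
  rewrite /L; case: nth => [[i j] k].
  by rewrite /polar linearP /= !mderivD !mderivZ mevalD mevalZ.
have /choice[P PE] q : exists P, forall v, polyfun P v = L q v.
  exact: linear_polyfun (L_lin q).
pose phi := [tuple P q | q < 14].
apply: (leq_variety_dim (phi := phi)) => Q Q0.
apply: (@jacobian_criterion K 14 slice_coord (fun=> 0)).
  rewrite (_ : \matrix_(_, _) _ = diag_mx (\row_p (slice_jacobian p p)%:R)).
    rewrite det_diag; apply/prodf_neq0 => p _; rewrite mxE pnatr_eq0.
    by rewrite slice_jacobian_diag eqxx.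
  apply/matrixP => p q; rewrite !mxE slice_coord_jacobian.
  have [->|pq] := eqVneq p q; first by rewrite mulr1n.
  by have := slice_jacobian_diag p q; rewrite pq => /eqP ->.
pose gt t : 'M[K]_4 := map_mx (meval t) slice_mx.
have QD0 : (Q \mPo slice_coord) * \det slice_mx = 0.
  apply: mpoly_meval0 => t; rewrite mevalM comp_mpoly_meval.
  have [gt0|gtU] := eqVneq (\det (gt t)) 0.
    by rewrite -det_map_mx -/(gt t) gt0 mulr0.
  have orb : GL4_orbit f (DHomog (whitney_subst_homog (gt t))).
    by exists (gt t); rewrite ?unitmxE ?unitfE // fE.
  rewrite -[X in X * _](meval_eq (v1 := fun q => polyfun (tnth phi q)
    (DHomog (whitney_subst_homog (gt t))))) ?(Q0 _ orb) ?mul0r // => q.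
  rewrite tnth_mktuple PE /L tnth_mktuple.
  case: (nth _ tangent_monomial q) => [[i j] k].
  rewrite [LHS]polar_whitney /whitney_polar !(mevalMn, mevalD, mevalM).
  by rewrite ![gt t _ _]mxE.
have /eqP := QD0; rewrite mulf_eq0 => /orP[/eqP //|/eqP D0].
have : (\det slice_mx).@[fun=> 0] = 1.
  rewrite -det_map_mx -(det1 K 4); congr (\det _).
  by apply/matrixP => a b; rewrite [LHS]mxE [LHS]slice_mx0 mxE.
by rewrite D0 meval0 => /esym/eqP; rewrite oner_eq0.
Qed.
End Whitney.

(** * Cubics that are singular along a line *)

Section Degenerate.
Variable K : numClosedFieldType.
Implicit Types f l m q : {mpoly K[4]}.

(** Cayley's ruled cubic x^2 z + x y w + y^3 and its degenerations.  The linear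
    forms need not be independent, so that the class is closed under all
    linear substitutions. *)
Definition pinched f := exists l1 l2 m1 m2 (e : K),
  [/\ [/\ l1 \is 1.-homog, l2 \is 1.-homog, m1 \is 1.-homog & m2 \is 1.-homog] &
      f = l1 ^+ 2 * m1 + l1 * l2 * m2 + e%:MP * l2 ^+ 3].

Definition has_plane f := exists l q,
  [/\ l \is 1.-homog, q \is 2.-homog & f = l * q].

Definition two_squares f := exists l1 l2 m1 m2,
  [/\ [/\ l1 \is 1.-homog, l2 \is 1.-homog, m1 \is 1.-homog & m2 \is 1.-homog] &
      f = l1 ^+ 2 * m1 + l2 ^+ 2 * m2].

(** The degree three part of the ideal (l1, l2)^2; the cubic is then singular
    along the line l1 = l2 = 0. *)
Definition has_double_line f := exists l1 l2 m1 m2 m3,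
  [/\ [/\ l1 \is 1.-homog & l2 \is 1.-homog],
      [/\ m1 \is 1.-homog, m2 \is 1.-homog & m3 \is 1.-homog] &
      f = l1 ^+ 2 * m1 + l1 * l2 * m2 + l2 ^+ 2 * m3].

Lemma homogC l (c : K) d : l \is d.-homog -> c%:MP * l \is d.-homog.
Proof. by move=> l1; rewrite mul_mpolyC rpredZ. Qed.

Lemma pinched_square l m : l \is 1.-homog -> m \is 1.-homog -> pinched (l ^+ 2 * m).
Proof.
move=> l1 m1; exists l, l, m, 0, 0; split; first by split=> //; exact: rpred0.
by rewrite mpolyC0; ring.
Qed.

Let lin4 := (homogC, rpredD, rpredB, rpredN).

(** Modulo l1 and l2 the form m3 is eliminated, leaving the pencil of binary
    quadratic forms l1^2 + p l2^2 and l1 l2 + q l2^2 as coefficients of m1 and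
    m2.  With n = l1 + q l2 this is the pencil of n^2 + k l2^2 and n l2.  It
    contains two distinct squares, unless k = 0; then n is a common factor and
    the cubic is pinched. *)
Lemma double_line_span l1 l2 m1 m2 (p q a b : K) :
  l1 \is 1.-homog -> l2 \is 1.-homog -> m1 \is 1.-homog -> m2 \is 1.-homog ->
  let m3 := a%:MP * l1 + b%:MP * l2 + p%:MP * m1 + q%:MP * m2 in
  let f := l1 ^+ 2 * m1 + l1 * l2 * m2 + l2 ^+ 2 * m3 in
  pinched f \/ two_squares f.
Proof.
move=> l1h l2h m1h m2h m3 f.
pose k := q ^+ 2 + p; pose n := l1 + q%:MP * l2.
have nh : n \is 1.-homog by rewrite !lin4.
pose c := m2 - (2 * q)%:MP * m1 + a%:MP * l2.
have ch : c \is 1.-homog by rewrite !lin4.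
pose e := b - a * q.
have fE : f = n ^+ 2 * m1 + n * l2 * c + k%:MP * l2 ^+ 2 * m1 + e%:MP * l2 ^+ 3.
  rewrite /f /m3 /c /k /e /n !(mpolyCD, mpolyCM, mpolyCB, rmorphXn, mpolyC_nat) /=.
  ring.
have [k0|k0] := eqVneq k 0.
  left; exists n, l2, m1, c, e; split=> //.
  by rewrite fE k0 mpolyC0; ring.
right; pose d := sqrtC k.
have dk : d ^+ 2 = k by exact: sqrtCK.
have d0 : d != 0 by apply: contra_neq k0 => d0; rewrite -dk d0 expr0n.
(* the squares of n + d l2 and n - d l2 span the same pencil as n^2 + k l2^2 and n l2 *)
pose A := (2^-1)%:MP * (m1 + (e / k)%:MP * l2).
pose B := (4 * d)^-1%:MP * (c - (e / k)%:MP * n).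
exists (n + d%:MP * l2), (n - d%:MP * l2), (A + B), (A - B).
split; first by split; rewrite !lin4.
have C2 : (2 : {mpoly K[4]}) * 2^-1%:MP = 1.
  by rewrite -mpolyC_nat -mpolyCM divff ?mpolyC1 // pnatr_eq0.
have C4 : (4 : {mpoly K[4]}) * d%:MP * (4 * d)^-1%:MP = 1.
  by rewrite -mpolyC_nat -!mpolyCM divff ?mpolyC1 // mulf_neq0 // pnatr_eq0.
have Ck : k%:MP * (e / k)%:MP = e%:MP :> {mpoly K[4]}.
  by rewrite -mpolyCM mulrC divfK.
have Cd : d%:MP ^+ 2 = k%:MP :> {mpoly K[4]} by rewrite -rmorphXn /= dk.
rewrite fE /A /B -Cd -Ck -Cd.
set d' := d%:MP in C4 Cd *; set h := 2^-1%:MP in C2 *; set r := (_ / k)%:MP.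
set s := (4 * d)^-1%:MP in C4 *.
transitivity ((2 * h) * (n ^+ 2 + d' ^+ 2 * l2 ^+ 2) * (m1 + r * l2) +
   (4 * d' * s) * (n * l2) * (c - r * n)); last by ring.
by rewrite C2 C4; ring.
Qed.

Lemma solve_relation (c : K) m x : c != 0 -> c%:MP * m + x = 0 -> m = (- c^-1)%:MP * x.
Proof.
move=> c0 /(congr1 ( *%R c^-1%:MP)); rewrite mulr0 mulrDr mulrA -mpolyCM.
by rewrite mulVf // mpolyC1 mul1r mpolyCN mulNr => /eqP; rewrite addr_eq0 => /eqP.
Qed.

Lemma five_linear_forms l1 l2 l3 l4 l5 :
  all (fun l => l \is 1.-homog) [:: l1; l2; l3; l4; l5] ->
  exists c1 c2 c3 c4 c5 : K,
    [|| c1 != 0, c2 != 0, c3 != 0, c4 != 0 | c5 != 0] /\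
    c1%:MP * l1 + c2%:MP * l2 + c3%:MP * l3 + c4%:MP * l4 + c5%:MP * l5 = 0.
Proof.
set s := [:: _; _; _; _; _] => /all_nthP s1.
have [i|//|u [i ui]] := @linear_forms_dependent _ 5 4 (fun i => nth 0 s i).
- exact: s1.
- by apply: leq_ltn_trans (rank_leq_col _) _.
rewrite !big_ord_recl big_ord0 /= addr0 -!mul_mpolyC !addrA => us.
do 5!eexists; split; last exact: us.
apply: contraNT ui; rewrite !negb_or !negbK => /and5P.
case: i => [[|[|[|[|[|//]]]]] lti] [/eqP u1 /eqP u2 /eqP u3 /eqP u4 /eqP u5]; apply/eqP;
  [rewrite -[RHS]u1|rewrite -[RHS]u2|rewrite -[RHS]u3|rewrite -[RHS]u4
    |rewrite -[RHS]u5]; congr u; exact: val_inj.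
Qed.

(** If a relation between the five linear forms involves m3 (or m1, by symmetry),
    it can be eliminated as above.  If among the m's it only involves m2, then
    eliminating m2 leaves two squares at once.  If it involves none of them, the
    two forms of the line are proportional. *)
Lemma has_double_line_cases f : has_double_line f -> pinched f \/ two_squares f.
Proof.
case=> l1 [l2 [m1 [m2 [m3 [[l1h l2h] [m1h m2h m3h] ->]]]]].
have [|c1 [c2 [p [q [r [nz rel]]]]]] := @five_linear_forms l1 l2 m1 m2 m3.
  by rewrite /= l1h l2h m1h m2h m3h.
have [r0|r0] := eqVneq r 0; last first.
  have -> : m3 = (- r^-1 * c1)%:MP * l1 + (- r^-1 * c2)%:MP * l2
      + (- r^-1 * p)%:MP * m1 + (- r^-1 * q)%:MP * m2.
    rewrite !mpolyCM -!mulrA -!mulrDr; apply: solve_relation => //.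
    by rewrite -[RHS]rel; ring.
  exact: double_line_span.
have [p0|p0] := eqVneq p 0; last first.
  have m1E : m1 = (- p^-1 * c2)%:MP * l2 + (- p^-1 * c1)%:MP * l1
      + (- p^-1 * r)%:MP * m3 + (- p^-1 * q)%:MP * m2.
    rewrite !mpolyCM -!mulrA -!mulrDr; apply: solve_relation => //.
    by rewrite -[RHS]rel; ring.
  rewrite (_ : _ + _ = l2 ^+ 2 * m3 + l2 * l1 * m2 + l1 ^+ 2 * m1); last by ring.
  rewrite m1E.
  exact: double_line_span.
have [q0|q0] := eqVneq q 0; last first.
  right; exists l1, l2, (m1 + (- q^-1 * c1)%:MP * l2), (m3 + (- q^-1 * c2)%:MP * l1).
  split; first by split; rewrite ?lin4.
  have -> : m2 = (- q^-1 * c1)%:MP * l1 + (- q^-1 * c2)%:MP * l2.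
    rewrite !mpolyCM -!mulrA -!mulrDr; apply: solve_relation => //.
    by rewrite -[RHS]rel p0 r0 mpolyC0; ring.
  by ring.
left; move: nz rel; rewrite p0 q0 r0 eqxx !orbF mpolyC0 !mul0r !addr0.
have [c10|c10 _ rel] := eqVneq c1 0; last first.
  have -> : l1 = (- c1^-1 * c2)%:MP * l2.
    by rewrite mpolyCM -mulrA; apply: solve_relation => //; rewrite -[RHS]rel; ring.
  set c := _%:MP; rewrite (_ : _ + _ = l2 ^+ 2 * (c ^+ 2 * m1 + c * m2 + m3)); last by ring.
  by apply: pinched_square; rewrite // -rmorphXn !lin4.
rewrite c10 mpolyC0 mul0r add0r /= => c20 /eqP.
rewrite mulf_eq0 mpolyC_eq0 (negbTE c20) /= => /eqP ->.
rewrite expr0n mul0r mulr0 mul0r !addr0.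
exact: pinched_square.
Qed.

(** Eliminating m1 leaves (l2^2 + c l1^2) m2 plus a multiple of l1^2.  A factor
    l2 - d l1 of the binary form, together with l1, exhibits the cubic as
    pinched. *)
Lemma two_squares_dependent l1 l2 m1 m2 (a b c : K) :
  l1 \is 1.-homog -> l2 \is 1.-homog -> m2 \is 1.-homog ->
  m1 = a%:MP * l1 + b%:MP * l2 + c%:MP * m2 ->
  pinched (l1 ^+ 2 * m1 + l2 ^+ 2 * m2).
Proof.
move=> l1h l2h m2h ->; pose d := sqrtC (- c).
have Cc : c%:MP = - d%:MP ^+ 2 :> {mpoly K[4]}.
  by rewrite -rmorphXn /= sqrtCK mpolyCN opprK.
exists (l2 - d%:MP * l1), l1, m2, ((2 * d)%:MP * m2 + b%:MP * l1), (a + b * d).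
split; first by split; rewrite ?lin4.
rewrite Cc !(mpolyCD, mpolyCM, mpolyC_nat); ring.
Qed.

Lemma two_squares_cases f : two_squares f -> pinched f \/
  exists2 g : 'M[K]_4, g \in unitmx & f = whitney K \mPo lin_subst g.
Proof.
case=> l1 [l2 [m1 [m2 [[l1h l2h m1h m2h] ->]]]].
pose l (i : 'I_4) := [:: l1; l2; m1; m2]`_i.
have lh i : l i \is 1.-homog by case: i => [[|[|[|[|//]]]] ?].
pose g : 'M[K]_4 := \matrix_(i, j) (l i)@_U_(j).
have [gU|gU] := boolP (g \in unitmx).
  right; exists g => //; rewrite whitney_lin_subst.
  have gE i : tnth (lin_subst g) i = l i.
    rewrite tnth_mktuple [RHS]linear_formE //.
    by apply: eq_bigr => j _; rewrite mxE.
  by rewrite !gE.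
left; have rk : (\rank g < 4)%N.
  by rewrite ltn_neqAle rank_leq_row andbT; move: gU; rewrite -row_full_unit.
have [u [i ui]] := linear_forms_dependent lh rk.
rewrite sum4 /l /= -!mul_mpolyC => rel.
have [u2|u2] := eqVneq (u i2) 0; last first.
  apply: (@two_squares_dependent _ _ _ _ (- (u i2)^-1 * u i0) (- (u i2)^-1 * u i1)
    (- (u i2)^-1 * u i3)) => //.
  rewrite !mpolyCM -!mulrA -!mulrDr; apply: solve_relation => //.
  by rewrite -[RHS]rel; ring.
have [u3|u3] := eqVneq (u i3) 0; last first.
  rewrite addrC.
  apply: (@two_squares_dependent _ _ _ _ (- (u i3)^-1 * u i1) (- (u i3)^-1 * u i0)
    (- (u i3)^-1 * u i2)) => //.
  rewrite !mpolyCM -!mulrA -!mulrDr; apply: solve_relation => //.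
  by rewrite -[RHS]rel; ring.
move: rel; rewrite u2 u3 mpolyC0 !mul0r !addr0 => rel.
have [u0|u0] := eqVneq (u i0) 0; last first.
  have -> : l1 = (- (u i0)^-1 * u i1)%:MP * l2 by rewrite mpolyCM -mulrA; apply: solve_relation.
  set c := _%:MP; rewrite (_ : _ + _ = l2 ^+ 2 * (c ^+ 2 * m1 + m2)); last by ring.
  by apply: pinched_square; rewrite // -rmorphXn !lin4.
have u1 : u i1 != 0.
  by move: i ui; apply: ord4P; rewrite ?u0 ?u2 ?u3 ?eqxx.
move: rel; rewrite u0 mpolyC0 mul0r add0r => /eqP.
rewrite mulf_eq0 mpolyC_eq0 (negbTE u1) /= => /eqP ->.
by rewrite expr0n mul0r addr0; apply: pinched_square.
Qed.
End Degenerate.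

(** * Dimension of the degenerate families *)

Section Bounds.
Variable K : numClosedFieldType.
Implicit Types f l m q : {mpoly K[4]}.
Let lin4 := (homogC, rpredD, rpredB, rpredN).

Lemma pivot l : l \is 1.-homog -> l != 0 ->
  exists i, exists2 c : K, c != 0 & exists2 m, m \is 1.-homog &
     l = c%:MP * m /\ m@_U_(i) = 1.
Proof.
move=> lh l0; have [i li] : exists i, l@_U_(i) != 0.
  apply/existsP; apply: contraNT l0; rewrite negb_exists => /forallP l0.
  rewrite (linear_formE lh) big1 // => i _.
  by have := l0 i; rewrite negbK => /eqP ->; rewrite scale0r.
exists i, l@_U_(i) => //; exists ((l@_U_(i))^-1%:MP * l); first exact: homogC.
by rewrite mulrA -mpolyCM divff // mpolyC1 mul1r mcoeffCM mulVf.
Qed.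

(** Normalizing a coefficient of l1 to 1, subtracting a multiple of l1 from l2
    and from m2, and normalizing a coefficient of l2 to 1, leaves 3, 2, 4 and 3
    free coefficients in l1, l2, m1 and m2.  Together with e these are 13
    parameters. *)
Lemma pinched_normal f : pinched f -> exists i j, i != j /\
  exists l1 l2 m1 m2 (e : K),
  [/\ [/\ l1 \is 1.-homog, l2 \is 1.-homog, m1 \is 1.-homog & m2 \is 1.-homog],
      l1@_U_(i) = 1, [/\ l2@_U_(i) = 0, l2@_U_(j) = 1 & m2@_U_(i) = 0] &
      f = l1 ^+ 2 * m1 + l1 * l2 * m2 + e%:MP * l2 ^+ 3].
Proof.
have X1 i : ('X_i : {mpoly K[4]}) \is 1.-homog by rewrite dhomogX; apply/eqP/mdeg1.
(* the normalization of l2 and m2, once l1 has coefficient 1 at i *)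
have step1 i l1 l2 m1 m2 (e : K) : l1 \is 1.-homog -> l2 \is 1.-homog ->
    m1 \is 1.-homog -> m2 \is 1.-homog -> l1@_U_(i) = 1 ->
    f = l1 ^+ 2 * m1 + l1 * l2 * m2 + e%:MP * l2 ^+ 3 ->
  exists i j, i != j /\
  exists l1 l2 m1 m2 (e : K),
  [/\ [/\ l1 \is 1.-homog, l2 \is 1.-homog, m1 \is 1.-homog & m2 \is 1.-homog],
      l1@_U_(i) = 1, [/\ l2@_U_(i) = 0, l2@_U_(j) = 1 & m2@_U_(i) = 0] &
      f = l1 ^+ 2 * m1 + l1 * l2 * m2 + e%:MP * l2 ^+ 3].
  move=> l1h l2h m1h m2h l1i fE.
  pose s := l2@_U_(i); pose n := l2 - s%:MP * l1.
  have nh : n \is 1.-homog by rewrite !lin4.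
  have ni : n@_U_(i) = 0 by rewrite mcoeffB mcoeffCM l1i mulr1 subrr.
  pose a2 := m2 + (3 * e * s)%:MP * n.
  pose a1 := m1 + s%:MP * m2 + (3 * e * s ^+ 2)%:MP * n + (e * s ^+ 3)%:MP * l1.
  have a1h : a1 \is 1.-homog by rewrite !lin4.
  have a2h : a2 \is 1.-homog by rewrite !lin4.
  have {}fE : f = l1 ^+ 2 * a1 + l1 * n * a2 + e%:MP * n ^+ 3.
    rewrite fE /a1 /a2 /n !(mpolyCM, rmorphXn, mpolyC_nat) /=; ring.
  pose u := a2@_U_(i).
  (* if l2 is a multiple of l1, the cubic is l1^2 a1 and any form can replace l2 *)
  have [n0|n0] := eqVneq n 0.
    have [j ij] : exists j, i != j.
      by move: (i); apply: ord4P; [exists i1|exists i0|exists i0|exists i0].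
    exists i, j; split=> //; exists l1, 'X_j, a1, 0, 0.
    rewrite rpred0 fE n0 mpolyC0 mcoeff0 !mcoeffXU eqxx eq_sym (negbTE ij).
    by split=> //; ring.
  have [j [c c0 [n' n'h [nE n'j]]]] := pivot nh n0.
  have n'i : n'@_U_(i) = 0.
    by move/eqP: ni; rewrite nE mcoeffCM mulf_eq0 (negbTE c0) => /eqP.
  have ij : i != j.
    by apply: contra_eq_neq n'i => ->; rewrite n'j oner_eq0.
  exists i, j; split=> //.
  exists l1, n', (a1 + (c * u)%:MP * n'), (c%:MP * (a2 - u%:MP * l1)), (e * c ^+ 3).
  split=> //; first by split; rewrite ?lin4.
    by split=> //; rewrite mcoeffCM mcoeffB mcoeffCM l1i mulr1 subrr mulr0.
  rewrite fE nE !(mpolyCM, rmorphXn) /=; ring.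
case=> l1 [l2 [m1 [m2 [e [[l1h l2h m1h m2h] fE]]]]].
have [l10|l10] := eqVneq l1 0; last first.
  have [i [c c0 [n nh [nE ni]]]] := pivot l1h l10.
  apply: (step1 i n l2 ((c ^+ 2)%:MP * m1) (c%:MP * m2) e); rewrite ?homogC //.
  by rewrite fE nE rmorphXn /=; ring.
have [l20|l20] := eqVneq l2 0.
  apply: (step1 i0 'X_i0 0 0 0 0); rewrite ?rpred0 ?mcoeffXU ?eqxx //.
  by rewrite fE l10 l20; ring.
have [i [c c0 [n nh [nE ni]]]] := pivot l2h l20.
apply: (step1 i n 0 ((e * c ^+ 3)%:MP * n) 0 0); rewrite ?rpred0 ?homogC //.
by rewrite fE l10 nE !(mpolyCM, rmorphXn) /=; ring.
Qed.

Definition param p : {mpoly {mpoly K[13]}[4]} := ('X_(inord p : 'I_13))%:MP.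

Definition point13 (s : seq K) (p : 'I_13) : K := s`_p.

Lemma map_param s p : (p < 13)%N ->
  map_mpoly (meval (point13 s)) (param p) = (s`_p)%:MP.
Proof. by move=> lt; rewrite map_mpolyC /= mevalXU /point13 inordK. Qed.

(** The normal form over an arbitrary ring: it is used both with generic and
    with scalar coefficients t. *)
Definition pinched_form (A : comNzRingType) (xi xj xk xl : A) (t : nat -> A) : A :=
  let l1 := xi + t 0%N * xj + t 1%N * xk + t 2%N * xl in
  let l2 := xj + t 3%N * xk + t 4%N * xl in
  let m1 := t 5%N * xi + t 6%N * xj + t 7%N * xk + t 8%N * xl in
  let m2 := t 9%N * xj + t 10%N * xk + t 11%N * xl in
  l1 ^+ 2 * m1 + l1 * l2 * m2 + t 12%N * l2 ^+ 3.

Lemma rmorph_pinched_form (A B : comNzRingType) (phi : {rmorphism A -> B})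
    xi xj xk xl t : phi (pinched_form xi xj xk xl t) =
  pinched_form (phi xi) (phi xj) (phi xk) (phi xl) (phi \o t).
Proof. by rewrite /pinched_form !(rmorphD, rmorphM, rmorphXn). Qed.

Definition pinched_family (s : 'I_4 * 'I_4 * 'I_4 * 'I_4) : {mpoly {mpoly K[13]}[4]} :=
  let: (i, j, k, l) := s in pinched_form 'X_i 'X_j 'X_k 'X_l param.

Lemma variety_dim_pinched (S : set (cubic_form K)) :
  (forall h, S h -> pinched (mpoly_of_dhomog h)) -> (variety_dim S <= 13)%N.
Proof.
move=> Sp; apply: (variety_dim_cubic_family (H := pinched_family)) => h.
case/Sp/pinched_normal => i [j [ij]].
move=> [l1 [l2 [m1 [m2 [e [[l1h l2h m1h m2h] l1i [l2i l2j m2i] ->]]]]]].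
have [k [l [_ _ sumE]]] := ord4_split ij; exists (i, j, k, l).
pose c (m : {mpoly K[4]}) a := m@_U_(a).
exists (point13 [:: c l1 j; c l1 k; c l1 l; c l2 k; c l2 l; c m1 i; c m1 j; c m1 k;
  c m1 l; c m2 j; c m2 k; c m2 l; e]).
rewrite [RHS]rmorph_pinched_form /= !map_mpolyX /pinched_form /comp !map_param //=.
have coordE (m : {mpoly K[4]}) : m \is 1.-homog ->
    m = (c m i)%:MP * 'X_i + (c m j)%:MP * 'X_j + (c m k)%:MP * 'X_k + (c m l)%:MP * 'X_l.
  by move=> mh; rewrite [LHS]linear_formE // sumE !mul_mpolyC.
rewrite [in LHS](coordE _ l1h) [in LHS](coordE _ l2h) [in LHS](coordE _ m1h)
  [in LHS](coordE _ m2h) [c l1 i]l1i [c l2 i]l2i [c l2 j]l2j [c m2 i]m2i.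
by rewrite mpolyC0 mpolyC1 !mul1r !mul0r !add0r.
Qed.

(** A linear form with first coefficient 1 times a general quadratic form:
    3 + 10 parameters. *)
Definition plane_form (A : comNzRingType) (xi xj xk xl x y z w : A) (t : nat -> A) : A :=
  (xi + t 0%N * xj + t 1%N * xk + t 2%N * xl) *
  (x * (t 3%N * x + t 4%N * y + t 5%N * z + t 6%N * w) +
   y * (t 7%N * y + t 8%N * z + t 9%N * w) +
   z * (t 10%N * z + t 11%N * w) + t 12%N * w ^+ 2).

Lemma rmorph_plane_form (A B : comNzRingType) (phi : {rmorphism A -> B})
    xi xj xk xl x y z w t : phi (plane_form xi xj xk xl x y z w t) =
  plane_form (phi xi) (phi xj) (phi xk) (phi xl) (phi x) (phi y) (phi z) (phi w)
    (phi \o t).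
Proof. by rewrite /plane_form !(rmorphD, rmorphM, rmorphXn). Qed.

Definition plane_family (s : 'I_4 * 'I_4 * 'I_4 * 'I_4) : {mpoly {mpoly K[13]}[4]} :=
  let: (i, j, k, l) := s in
  plane_form 'X_i 'X_j 'X_k 'X_l 'X_i0 'X_i1 'X_i2 'X_i3 param.

Lemma quadratic_formE q : q \is 2.-homog ->
  exists S : 'I_4 -> 'I_4 -> K, q = \sum_i 'X_i * \sum_j (S i j)%:MP * 'X_j.
Proof.
move=> q2; exists (fun i j => 2^-1 * q^`M(i)@_U_(j)).
have C2 : (2^-1)%:MP *+ 2 = 1 :> {mpoly K[4]}.
  by rewrite -mpolyCMn -[_ *+ 2]mulr_natr mulVf ?mpolyC1 // pnatr_eq0.
rewrite -[LHS]mul1r -C2 mulrnAl -mulrnAr -(dhomog_euler q2) mulr_sumr.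
apply: eq_bigr => i _; rewrite mulrCA; congr (_ * _).
rewrite [in LHS](linear_formE (dhomog_mderiv i q2)) mulr_sumr.
by apply: eq_bigr => j _; rewrite mpolyCM -mulrA -mul_mpolyC.
Qed.

Lemma variety_dim_plane (S : set (cubic_form K)) :
  (forall h, S h -> has_plane (mpoly_of_dhomog h)) -> (variety_dim S <= 13)%N.
Proof.
move=> Sp; apply: (variety_dim_cubic_family (H := plane_family)) => h.
move/Sp => [l [q [lh qh hE]]].
have [i [l1 [q1 [l1h l1i q1h {}hE]]]] : exists i l1 q1, [/\ l1 \is 1.-homog,
    l1@_U_(i) = 1, q1 \is 2.-homog & mpoly_of_dhomog h = l1 * q1].
  have [l0|l0] := eqVneq l 0.
    exists i0, 'X_i0, 0; rewrite dhomogX rpred0 mcoeffXU eqxx.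
    by split=> //; [exact/eqP/mdeg1|rewrite hE l0 mul0r mulr0].
  have [i [c c0 [n nh [nE ni]]]] := pivot lh l0.
  exists i, n, (c%:MP * q); split; rewrite ?homogC //.
  by rewrite hE nE; ring.
have [j ij] : exists j, i != j.
  by move: (i); apply: ord4P; [exists i1|exists i0|exists i0|exists i0].
have [k [l' [_ _ sumE]]] := ord4_split ij; exists (i, j, k, l').
have [s qE] := quadratic_formE q1h.
exists (point13 [:: l1@_U_(j); l1@_U_(k); l1@_U_(l'); s i0 i0; s i0 i1 + s i1 i0;
  s i0 i2 + s i2 i0; s i0 i3 + s i3 i0; s i1 i1; s i1 i2 + s i2 i1; s i1 i3 + s i3 i1;
  s i2 i2; s i2 i3 + s i3 i2; s i3 i3]).
rewrite [RHS]rmorph_plane_form /= !map_mpolyX /plane_form /comp !map_param //=.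
rewrite hE [in LHS](linear_formE l1h) sumE l1i qE !sum4 -!mul_mpolyC mpolyC1 !mpolyCD.
ring.
Qed.

Lemma pinched_subst f g : pinched f -> pinched (f \mPo lin_subst g).
Proof.
move=> [l1 [l2 [m1 [m2 [e [[l1h l2h m1h m2h] ->]]]]]].
pose s p := p \mPo lin_subst g; exists (s l1), (s l2), (s m1), (s m2), e.
split; first by split; apply: dhomog_lin_subst.
by rewrite !(rmorphD, rmorphM, rmorphXn) /= comp_mpolyC.
Qed.

Lemma has_plane_subst f g : has_plane f -> has_plane (f \mPo lin_subst g).
Proof.
move=> [l [q [lh qh ->]]]; exists (l \mPo lin_subst g), (q \mPo lin_subst g).
by rewrite !dhomog_lin_subst // rmorphM.
Qed.
End Bounds.

(** * Singular points *)

Section Subst.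
Variable K : fieldType.

Definition singular_at (f : {mpoly K[4]}) (v : 'rV[K]_4) :=
  forall i, (f^`M(i)).@[fun j => v 0 j] = 0.

(** The gradient of f o B^T at x is the image under B of the gradient of f at
    x B.  So if the rows of B are singular vectors of f, then the transformed
    cubic is singular at the coordinate vectors. *)
Lemma singular_at_subst f (B : 'M[K]_4) x :
  singular_at f (x *m B) -> singular_at (f \mPo lin_subst B^T) x.
Proof.
move=> fx i; rewrite mderiv_comp_lin_subst raddf_sum big1 // => a _ /=.
rewrite mevalZ comp_mpoly_meval; set e := _.@[_].
suff -> : e = 0 by rewrite mulr0.
rewrite -(fx a); apply: meval_eq => j; rewrite tnth_mktuple raddf_sum mxE.
by apply: eq_bigr => k _; rewrite /= mevalZ mevalXU mxE mulrC.
Qed.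

Lemma free_complete (s : seq 'rV[K]_4) : free s ->
  exists2 B : 'M[K]_4, B \in unitmx & forall i : 'I_4, (i < size s)%N -> row i B = s`_i.
Proof.
move=> fs; pose t := s ++ vbasis (<<s>>^C).
have bt : basis_of {:'rV[K]_4} t.
  rewrite -(addv_complf <<s>>); apply: cat_basis (vbasisP _).
    by apply/directv_addP; rewrite capv_compl.
  by rewrite /basis_of eqxx.
have st : size t = 4.
  have /andP[/eqP tE /eqnP <-] := bt; rewrite tE dimvf /dim /= mul1n //.
have := basis_free bt; rewrite -[t](in_tupleE).
move=> /freeP ft.
pose B := \matrix_(i < 4) t`_i.
exists B => [|i lti]; last by rewrite rowK nth_cat lti.
rewrite -row_free_unit -kermx_eq0; apply: contraT => /rowV0Pn[u /sub_kermxP uB /rV0Pn[j uj]].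
have ltj : (j < size t)%N by rewrite st.
pose c (i : 'I_(size t)) := u 0 (cast_ord st i).
have := ft c; rewrite /c => /(_ _ (Ordinal ltj)) cj; move/negP: uj => [].
apply/eqP; rewrite -[RHS]cj; first by congr (u _ _); apply: val_inj.
rewrite -[RHS]uB mulmx_sum_row (reindex (cast_ord st)) /=; last first.
  by apply: onW_bij; exists (cast_ord (esym st)) => i; rewrite ?cast_ordK ?cast_ordKV.
by apply: eq_bigr => i _; rewrite rowK.
Qed.
End Subst.

Section Polar.
Variable K : numClosedFieldType.
Variable h : {mpoly K[4]}.
Hypothesis h3 : h \is 3.-homog.

Local Notation T := (polar h).

Lemma polarC12 i j k : T i j k = T j i k.
Proof. by rewrite /polar [h^`M(i)^`M(j)]mderiv_comm. Qed.

Lemma polarC23 i j k : T i j k = T i k j.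
Proof. by rewrite /polar mderiv_comm. Qed.

Lemma mderiv2E i j : h^`M(i)^`M(j) = \sum_k (T i j k)%:MP * 'X_k.
Proof.
have p1 : h^`M(i)^`M(j) \is 1.-homog := dhomog_mderiv j (dhomog_mderiv i h3).
rewrite [LHS]linear_formE //; apply: eq_bigr => k _; rewrite mul_mpolyC; congr (_ *: _).
rewrite /polar; set p := _^`M(j) in p1 *.
by rewrite (mderiv_linear _ p1) mevalC.
Qed.

Lemma singular_atE x k : singular_at h x ->
  \sum_i \sum_j T i j k * (x 0 i * x 0 j) = 0.
Proof.
move=> /(_ k) hx; transitivity ((h^`M(k)).@[fun j => x 0 j] *+ 2); last first.
  by rewrite hx mul0rn.
rewrite -mevalMn -(dhomog_euler (dhomog_mderiv k h3)) raddf_sum /=.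
apply: eq_bigr => i _; rewrite mevalM mevalXU mderiv2E raddf_sum mulr_sumr /=.
apply: eq_bigr => j _; rewrite mevalM mevalC mevalXU polarC23 polarC12.
by rewrite mulrCA.
Qed.

(** Euler's formula, applied three times. *)
Lemma polarE : h = (6%:R^-1)%:MP * \sum_i \sum_j \sum_k (T i j k)%:MP * ('X_i * 'X_j * 'X_k).
Proof.
have C6 : (6%:R^-1)%:MP *+ 6 = 1 :> {mpoly K[4]}.
  by rewrite -mpolyCMn -[_ *+ 6]mulr_natr mulVf ?mpolyC1 // pnatr_eq0.
rewrite -[LHS]mul1r -C6 mulrnAl -mulrnAr; congr (_ * _).
rewrite -[6%N]/(3 * 2)%N mulrnA -(dhomog_euler h3) -sumrMnl; apply: eq_bigr => i _.
rewrite -mulrnAr -(dhomog_euler (dhomog_mderiv i h3)) mulr_sumr.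
apply: eq_bigr => j _; rewrite mderiv2E !mulr_sumr; apply: eq_bigr => k _.
by ring.
Qed.

Lemma singular_vertex a k : singular_at h (delta_mx 0 a) -> T a a k = 0.
Proof.
move/(singular_atE k) => <-; rewrite (bigD1 a) //= [X in _ + X]big1 => [|i ia].
  rewrite (bigD1 a) //= big1 => [|j ja]; first by rewrite !mxE !eqxx !mulr1 !addr0.
  by rewrite !mxE (negbTE ja) andbF mulr0 mulr0.
by apply: big1 => j _; rewrite !mxE (negbTE ia) andbF mul0r mulr0.
Qed.

(** Every monomial with a nonzero coefficient then contains the variable x_c. *)
Lemma plane_of_polar c :
  (forall i j k, i != c -> j != c -> k != c -> T i j k = 0) -> has_plane h.
Proof.
move=> Tc.
have Xh i : 'X_i \is [in K[4], 1.-homog] by rewrite dhomogX; apply/eqP/mdeg1.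
have XX i j : 'X_i * 'X_j \is [in K[4], 2.-homog] by apply: (dhomogM (Xh i) (Xh j)).
pose q := \sum_j \sum_k (T c j k)%:MP * ('X_j * 'X_k) +
  \sum_(i | i != c) (\sum_k (T i c k)%:MP * ('X_i * 'X_k) +
    \sum_(j | j != c) (T i j c)%:MP * ('X_i * 'X_j)).
have qh : q \is 2.-homog.
  by rewrite rpredD ?rpred_sum // => i _; rewrite ?rpredD ?rpred_sum // => j _;
    rewrite ?rpred_sum // => *; rewrite homogC.
exists 'X_c, ((6%:R^-1)%:MP * q); split; rewrite ?homogC //.
rewrite [LHS]polarE mulrCA; congr (_ * _).
rewrite (bigD1 c) //= /q mulrDr mulr_sumr; congr (_ + _).
  apply: eq_bigr => j _; rewrite mulr_sumr; apply: eq_bigr => k _; ring.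
rewrite mulr_sumr; apply: eq_bigr => i ic.
rewrite (bigD1 c) //= mulrDr mulr_sumr; congr (_ + _).
  by apply: eq_bigr => k _; ring.
rewrite mulr_sumr; apply: eq_bigr => j jc.
rewrite (bigD1 c) //= big1 => [|k kc]; first by ring.
by rewrite Tc // mpolyC0 mul0r.
Qed.

(** Three collinear singular points are placed at e0, e1 and a e0 + b e1.  The
    third one gives 2 a b T(e0, e1, .) = 0, so no monomial of h contains two of
    the variables x0 and x1, counted with multiplicity. *)
Lemma singular_line (a b : K) : a != 0 -> b != 0 ->
  singular_at h (delta_mx 0 i0) -> singular_at h (delta_mx 0 i1) ->
  singular_at h (a *: delta_mx 0 i0 + b *: delta_mx 0 i1) -> has_double_line h.
Proof.
move=> a0 b0 h0 h1 hab.
have T00 k : T i0 i0 k = 0 by apply: singular_vertex.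
have T11 k : T i1 i1 k = 0 by apply: singular_vertex.
have T01 k : T i0 i1 k = 0.
  have := singular_atE k hab; rewrite !sum4 !mxE /=.
  rewrite T00 T11 (polarC12 i1 i0) !(mulr1, mulr0, mul0r, addr0, add0r) => /eqP.
  rewrite [b * a]mulrC -mulr2n mulrn_eq0 /= !mulf_eq0 (negbTE a0) (negbTE b0) !orbF.
  by move/eqP.
have Xh i : 'X_i \is [in K[4], 1.-homog] by rewrite dhomogX; apply/eqP/mdeg1.
pose C6 : {mpoly K[4]} := (6%:R^-1)%:MP.
pose D i j : {mpoly K[4]} := \sum_k (T i j k)%:MP * 'X_k.
have hE : h = C6 * \sum_i \sum_j 'X_i * 'X_j * D i j.
  rewrite [LHS]polarE; congr (_ * _).
  apply: eq_bigr => i _; apply: eq_bigr => j _; rewrite mulr_sumr.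
  by apply: eq_bigr => k _; rewrite mulrCA.
(* D i j is the second derivative of h, a linear form *)
have DC i j : D i j = D j i by apply: eq_bigr => k _; rewrite polarC12.
have Dh i j : D i j \is 1.-homog by apply: rpred_sum => k _; rewrite homogC.
have D0 i j : (forall k, T i j k = 0) -> D i j = 0.
  by move=> Tij; apply: big1 => k _; rewrite Tij mpolyC0 mul0r.
have Z00 := D0 _ _ T00. have Z01 := D0 _ _ T01. have Z11 := D0 _ _ T11.
have D23 i : i = i0 \/ i = i1 -> forall j,
    D i j = (T i j i2)%:MP * 'X_i2 + (T i j i3)%:MP * 'X_i3.
  move=> iE j; rewrite /D sum4 [_ * 'X_i0 + _](_ : _ = 0) ?add0r //.
  by case: iE => ->; rewrite !(polarC23 _ j) ?T00 ?T01 ?(polarC12 i1 i0) ?T11 ?T01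
    !mpolyC0 !mul0r addr0.
have X2 : 2%:MP = 2 :> {mpoly K[4]} by rewrite mpolyC_nat.
clearbody D.
exists 'X_i2, 'X_i3,
  (C6 * (2%:MP * ((T i0 i2 i2)%:MP * 'X_i0 + (T i1 i2 i2)%:MP * 'X_i1) + D i2 i2)),
  (C6 * (2%:MP * ((T i0 i2 i3)%:MP * 'X_i0 + (T i1 i2 i3)%:MP * 'X_i1 +
     (T i0 i3 i2)%:MP * 'X_i0 + (T i1 i3 i2)%:MP * 'X_i1 + D i2 i3))),
  (C6 * (2%:MP * ((T i0 i3 i3)%:MP * 'X_i0 + (T i1 i3 i3)%:MP * 'X_i1) + D i3 i3)).
split; [by []|by split; rewrite !(homogC, rpredD)|].
have [D02 D03] : D i0 i2 = (T i0 i2 i2)%:MP * 'X_i2 + (T i0 i2 i3)%:MP * 'X_i3 /\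
    D i0 i3 = (T i0 i3 i2)%:MP * 'X_i2 + (T i0 i3 i3)%:MP * 'X_i3.
  by split; apply: D23; left.
have [D12 D13] : D i1 i2 = (T i1 i2 i2)%:MP * 'X_i2 + (T i1 i2 i3)%:MP * 'X_i3 /\
    D i1 i3 = (T i1 i3 i2)%:MP * 'X_i2 + (T i1 i3 i3)%:MP * 'X_i3.
  by split; apply: D23; right.
rewrite [LHS]hE. 
rewrite !sum4.
rewrite (DC i1 i0) (DC i2 i0) (DC i2 i1) (DC i3 i0) (DC i3 i1) (DC i3 i2).
rewrite Z00 Z01 Z11.
rewrite D02 D03 D12 D13.
rewrite X2.
move: (D i2 i2) (D i2 i3) (D i3 i3) (T i0 i2 i2)%:MP (T i0 i2 i3)%:MP (T i0 i3 i2)%:MP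
  (T i0 i3 i3)%:MP (T i1 i2 i2)%:MP (T i1 i2 i3)%:MP (T i1 i3 i2)%:MP (T i1 i3 i3)%:MP.
move=> *.
ring.
Qed.

(** Singularity at the vertices other than d kills all coefficients with a
    repeated index among a, b, c; the only monomial free of x_d that remains
    is x_a x_b x_c. *)
Lemma singular_triangle a b c d : (forall i, i \in [:: a; b; c; d]) ->
  (forall i, i != d -> singular_at h (delta_mx 0 i)) -> T a b c = 0 -> has_plane h.
Proof.
move=> cover hv Tabc; apply: (@plane_of_polar d) => i j k id jd kd.
have T0 l m : l != d -> T l l m = 0 by move=> ld; apply/singular_vertex/hv.
have E l : l != d -> [\/ l = a, l = b | l = c].
  move=> ld; have := cover l; rewrite !inE (negbTE ld) orbF.
  by case/or3P => /eqP ->; [constructor 1|constructor 2|constructor 3].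
have [ij|ij] := eqVneq i j; first by rewrite ij T0.
have [jk|jk] := eqVneq j k; first by rewrite jk polarC12 polarC23 T0.
have [ik|ik] := eqVneq i k; first by rewrite ik polarC23 T0.
by case: (E i id) ij ik => ->; case: (E j jd) jk => ->; case: (E k kd) => ->;
  rewrite ?eqxx // => _ _ _; first [by []|by rewrite polarC23|by rewrite polarC12
  |by rewrite polarC12 polarC23|by rewrite polarC23 polarC12
  |by rewrite polarC12 polarC23 polarC12].
Qed.

(** The c-th component of the gradient at x, twice over, when h is singular at
    the vertices a, b and c. *)
Lemma singular_point_relation a b c d x :
  (forall (M : nmodType) (F : 'I_4 -> M), \sum_i F i = F a + F b + F c + F d) ->
  singular_at h (delta_mx 0 a) -> singular_at h (delta_mx 0 b) ->
  singular_at h (delta_mx 0 c) -> singular_at h x ->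
  (T a b c * (x 0 a * x 0 b) + T a c d * (x 0 a * x 0 d) + T b c d * (x 0 b * x 0 d)
   + T c c d * (x 0 c * x 0 d)) *+ 2 + T d d c * x 0 d ^+ 2 = 0.
Proof.
move=> sumE ha hb hc hx; have hxc := singular_atE c hx.
have Tcac : T c a c = 0 by rewrite polarC23 singular_vertex.
have Tcbc : T c b c = 0 by rewrite polarC23 singular_vertex.
have Tacc : T a c c = 0 by rewrite polarC12.
have Tbcc : T b c c = 0 by rewrite polarC12.
rewrite -[RHS]hxc !sumE Tcac Tcbc Tacc Tbcc.
rewrite (singular_vertex c ha) (singular_vertex c hb) (singular_vertex c hc).
rewrite (polarC12 b a) (polarC12 d a) (polarC12 d b).
rewrite (polarC12 d c) (polarC23 a d) (polarC23 b d) (polarC23 c d).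
ring.
Qed.

Lemma singular_coplanar a b d x :
  uniq [:: a; b; d] -> (forall i, i != d -> singular_at h (delta_mx 0 i)) ->
  singular_at h x -> x 0 d = 0 -> x 0 a != 0 -> x 0 b != 0 -> has_plane h.
Proof.
rewrite /= !inE negb_or !andbT => /andP[/andP[ab ad] bd] hv hx xd xa xb.
have [c [cd cover sumE]] : exists c, [/\ c != d, forall i, i \in [:: a; b; c; d] &
    forall (M : nmodType) (F : 'I_4 -> M), \sum_i F i = F a + F b + F c + F d].
  have [k [l [klU kl kE]]] := ord4_split ab.
  move: klU; rewrite /= !inE !negb_or !andbT => /and3P[_ _ kl'].
  have := kl d; rewrite !inE ![d == _]eq_sym (negbTE ad) (negbTE bd) /=.
  case/orP => /eqP <-; [exists l|exists k]; split=> // [|i|M F].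
  - by rewrite eq_sym.
  - by have := kl i; rewrite !inE [(i == l) || _]orbC.
  - by rewrite kE addrAC.
apply: (singular_triangle cover hv).
have := singular_point_relation sumE (hv a ad) (hv b bd) (hv c cd) hx.
rewrite xd expr0n /= !mulr0 !addr0 => /eqP.
by rewrite mulrn_eq0 /= !mulf_eq0 (negbTE xa) (negbTE xb) !orbF => /eqP.
Qed.

(** Unless a coordinate of x vanishes, which is the coplanar case, the four
    relations obtained from the components of the gradient at x form an
    invertible linear system for the four remaining coefficients of h. *)
Lemma singular_five a b x : a != b -> (forall i, singular_at h (delta_mx 0 i)) ->
  singular_at h x -> x 0 a != 0 -> x 0 b != 0 -> has_plane h.
Proof.
move=> ab hv hx xa xb; have [c [d [U cover sumE]]] := ord4_split ab.
move: (U); rewrite /= !inE !negb_or !andbT => /and3P[/and3P[_ ac ad] /andP[bc bd] cd].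
have [xd|xd] := eqVneq (x 0 d) 0.
  by apply: (@singular_coplanar a b d x) => //; rewrite /= !inE negb_or ab ad bd.
have [xc|xc] := eqVneq (x 0 c) 0.
  by apply: (@singular_coplanar a b c x) => //; rewrite /= !inE negb_or ab ac bc.
have T0 i j : T i i j = 0 by apply: singular_vertex.
have rel p q r s (sE : forall (M : nmodType) (F : 'I_4 -> M),
    \sum_i F i = F p + F q + F r + F s) :
    T p q r * (x 0 p * x 0 q) + T p r s * (x 0 p * x 0 s) + T q r s * (x 0 q * x 0 s) = 0.
  have := singular_point_relation sE (hv p) (hv q) (hv r) hx.
  rewrite !T0 !mul0r !addr0 => /eqP; rewrite mulrn_eq0 /= => /eqP //.
have Ec := rel a b c d sumE.
have Ed : T a b d * (x 0 a * x 0 b) + T a d c * (x 0 a * x 0 c) +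
    T b d c * (x 0 b * x 0 c) = 0 by apply: rel => M F; rewrite sumE addrAC.
have Ea : T c b a * (x 0 c * x 0 b) + T c a d * (x 0 c * x 0 d) +
    T b a d * (x 0 b * x 0 d) = 0.
  by apply: rel => M F; rewrite sumE -!addrA [F b + _]addrCA addrCA [F a + _]addrCA.
have Eb : T a c b * (x 0 a * x 0 c) + T a b d * (x 0 a * x 0 d) +
    T c b d * (x 0 c * x 0 d) = 0 by apply: rel => M F; rewrite sumE [F a + F b + _]addrAC.
apply: (singular_triangle cover) => //.
move: Ec Ed Ea Eb.
rewrite (polarC23 a d c) (polarC23 b d c) (polarC12 c b a) (polarC23 b c a)
  (polarC12 b a c) (polarC12 c a d) (polarC12 b a d) (polarC23 a c b) (polarC12 c b d).
set p := T a b c; set q := T a b d; set r := T a c d; set s := T b c d.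
move: (x 0 a) (x 0 b) (x 0 c) (x 0 d) xa xb xc xd => xa xb xc xd xa0 xb0 xc0 xd0.
move=> Ec Ed Ea Eb.
have : (p * (xa * xb * xc)) *+ 3 = 0.
  (* Multiplying the relation for k by x_k makes the system a constant one in the
     four products such as p x_a x_b x_c. *)
  rewrite (_ : _ *+ 3 =
    xc * (p * (xa * xb) + r * (xa * xd) + s * (xb * xd))
    - xd * (q * (xa * xb) + r * (xa * xc) + s * (xb * xc)) *+ 2
    + xa * (p * (xc * xb) + r * (xc * xd) + q * (xb * xd))
    + xb * (p * (xa * xc) + q * (xa * xd) + s * (xc * xd))); last by ring.
  by rewrite Ec Ed Ea Eb !mulr0 mul0rn subr0 !addr0.
by move/eqP; rewrite mulrn_eq0 /= !mulf_eq0 (negbTE xa0) (negbTE xb0) (negbTE xc0) !orbF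
  => /eqP.
Qed.

End Polar.

Section FivePoints.
Variable K : numClosedFieldType.

Lemma has_plane_basis f (B : 'M[K]_4) : B \in unitmx ->
  has_plane (f \mPo lin_subst B^T) -> has_plane f.
Proof.
move=> BU /(has_plane_subst (invmx B^T)).
by rewrite lin_subst_comp mulmxV ?unitmx_tr // lin_subst1.
Qed.

Lemma has_double_line_subst f (g : 'M[K]_4) : has_double_line f ->
  has_double_line (f \mPo lin_subst g).
Proof.
move=> [l1 [l2 [m1 [m2 [m3 [[l1h l2h] [m1h m2h m3h] ->]]]]]].
pose s p := p \mPo lin_subst g; exists (s l1), (s l2), (s m1), (s m2), (s m3).
split; [by split; apply: dhomog_lin_subst|by split; apply: dhomog_lin_subst|].
by rewrite !(rmorphD, rmorphM, rmorphXn).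
Qed.

Lemma has_double_line_basis f (B : 'M[K]_4) : B \in unitmx ->
  has_double_line (f \mPo lin_subst B^T) -> has_double_line f.
Proof.
move=> BU /(has_double_line_subst (invmx B^T)).
by rewrite lin_subst_comp mulmxV ?unitmx_tr // lin_subst1.
Qed.

Lemma two_coordinates (x : 'rV[K]_4) (B : 'M[K]_4) : x *m B != 0 ->
  (forall a, x 0 a != 0 -> x *m B != x 0 a *: row a B) ->
  exists a b, [/\ a != b, x 0 a != 0 & x 0 b != 0].
Proof.
move=> xB0 xBa; have [a xa] : exists a, x 0 a != 0.
  by apply/rV0Pn; apply: contra_neq xB0 => ->; rewrite mul0mx.
suff /existsP[b /andP[ab xb]] : [exists b, (a != b) && (x 0 b != 0)] by exists a, b.
apply: contraNT (xBa a xa); rewrite negb_exists => /forallP xb.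
apply/eqP; rewrite mulmx_sum_row (bigD1 a) //= big1 ?addr0 // => b ba.
move: (xb b); rewrite eq_sym ba /= negbK => /eqP ->; exact: scale0r.
Qed.

(** The vectors are added to a basis as long as they are independent.  The first
    one that depends on its predecessors has at least two nonzero coordinates,
    since no two of the points coincide; it is the third, fourth or fifth. *)
Lemma five_singular_points f (v : 'I_5 -> 'rV[K]_4) : f \is 3.-homog ->
  (forall i, v i != 0) -> (forall i j c, i != j -> v i != c *: v j) ->
  (forall i, singular_at f (v i)) -> has_plane f \/ has_double_line f.
Proof.
move=> f3 v0 vP fv.
pose w (k : nat) := v (inord k).
have wP j k c : (j < 5)%N -> (k < 5)%N -> j != k -> w j != c *: w k.
  by move=> lj lk jk; apply: vP; rewrite -(inj_eq val_inj) /= !inordK.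
have sing B x i : x *m B = v i -> singular_at (f \mPo lin_subst B^T) x.
  by move=> xB; apply: singular_at_subst; rewrite xB.
have vertex (B : 'M[K]_4) a k : row a B = w k ->
    singular_at (f \mPo lin_subst B^T) (delta_mx 0 a).
  by rewrite rowE => /sing.
have h3 B := dhomog_lin_subst (B^T) f3.
have free2 : free [:: w 1%N; w 0%N].
  rewrite free_cons span_seq1 seq1_free /w v0 andbT.
  by apply/negP => /vlineP[c]; apply/eqP/(wP 1%N 0%N).
have [free3|] := boolP (free [:: w 2%N; w 1%N; w 0%N]); last first.
  rewrite free_cons free2 andbT negbK -[[:: _; _]]/(val [tuple w 1%N; w 0%N]).
  move=> /coord_span; rewrite !big_ord_recl big_ord0 addr0 /=.
  set a := coord _ _ _; set b := coord _ _ _ => w2E.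
  have [B BU Brow] := free_complete free2.
  right; apply: (has_double_line_basis BU).
  have r0 := Brow i0 isT; have r1 := Brow i1 isT.
  apply: (@singular_line _ _ (h3 B) a b); [| |exact: vertex r0|exact: vertex r1|].
  - by apply: contraNneq (wP 2%N 0%N b isT isT isT) => a0; rewrite w2E a0 scale0r add0r.
  - by apply: contraNneq (wP 2%N 1%N a isT isT isT) => b0; rewrite w2E b0 scale0r addr0.
  - apply: (sing _ _ (inord 2)); rewrite mulmxDl -!scalemxAl -!rowE r0 r1 -/(w 2%N) w2E.
    by [].
left; have [free4|] := boolP (free [:: w 3%N; w 2%N; w 1%N; w 0%N]); last first.
  rewrite free_cons free3 andbT negbK -[[:: _; _; _]]/(val [tuple w 2%N; w 1%N; w 0%N]).
  move=> /coord_span; rewrite !big_ord_recl big_ord0 addr0 /=.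
  set a := coord _ _ _; set b := coord _ _ _; set c := coord _ _ _ => w3E.
  have [B BU Brow] := free_complete free3.
  apply: (has_plane_basis BU).
  have r0 := Brow i0 isT; have r1 := Brow i1 isT; have r2 := Brow i2 isT.
  pose x := a *: delta_mx 0 i0 + b *: delta_mx 0 i1 + c *: delta_mx 0 i2 : 'rV[K]_4.
  have xB : x *m B = w 3%N.
    by rewrite !mulmxDl -!scalemxAl -!rowE r0 r1 r2 w3E -addrA.
  have x3 : x 0 i3 = 0 by rewrite !mxE /= !mulr0 !addr0.
  have [k [l [kl xk xl]]] : exists k l, [/\ k != l, x 0 k != 0 & x 0 l != 0].
    apply: (@two_coordinates _ B); rewrite xB; first exact: v0.
    apply: ord4P => xa; rewrite ?r0 ?r1 ?r2; try exact: wP.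
    by rewrite x3 eqxx in xa.
  have ne3 m : x 0 m != 0 -> m != i3 by apply: contra_neq => ->.
  apply: (@singular_coplanar _ _ (h3 B) k l i3 x) => //.
  - by rewrite /= !inE negb_or kl !ne3.
  - by apply: ord4P => // _; apply: vertex; [exact: r0|exact: r1|exact: r2].
  - exact: sing xB.
have [B BU Brow] := free_complete free4.
apply: (has_plane_basis BU).
pose x := w 4%N *m invmx B.
have xB : x *m B = w 4%N by rewrite mulmxKV.
have rB (a : 'I_4) : row a B = w (3 - a)%N.
  by move: a; apply: ord4P; exact: Brow.
have [k [l [kl xk xl]]] : exists k l, [/\ k != l, x 0 k != 0 & x 0 l != 0].
  apply: (@two_coordinates _ B); rewrite xB; first exact: v0.
  by move=> a _; rewrite rB; apply: wP; lia.
apply: (@singular_five _ _ (h3 B) k l x) => //; last exact: sing xB.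
by move=> a; apply: vertex (rB a).
Qed.

Lemma infinitely_singular_cases (f : cubic_form K) :
  infinite_set (singular_points f) ->
  has_plane (mpoly_of_dhomog f) \/ has_double_line (mpoly_of_dhomog f).
Proof.
move=> /(@infinite_set_fset _ _ 5)[B BS B5].
pose p (i : 'I_5) := nth 0%VS (enum_fset B) i.
have ltB (i : 'I_5) : (i < size (enum_fset B))%N by apply: leq_trans B5.
have pS i : singular_points f (p i) by apply: BS; apply: mem_nth.
have pline i : p i = <[vpick (p i)]>%VS.
  apply/esym/eqP; rewrite eqEdim -memvE memv_pick dim_vline vpick0.
  by have [p1 _] := pS i; rewrite -dimv_eq0 p1.
apply: (@five_singular_points _ (fun i => vpick (p i))).
- exact: dhomog_is_dhomog.
- by move=> i; rewrite vpick0; have [p1 _] := pS i; rewrite -dimv_eq0 p1.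
- move=> i j c ij; apply: contra_neq ij => ijc.
  have : p i = p j.
    have [p1 _] := pS i; have [p2 _] := pS j.
    apply/eqP; rewrite eqEdim p1 p2 leqnn andbT pline ijc -memvE.
    by rewrite memvZ // memv_pick.
  move/eqP; rewrite /p nth_uniq ?ltB ?fset_uniq // => /eqP; exact: val_inj.
- by move=> i j; have [_] := pS i; apply; apply: memv_pick.
Qed.
End FivePoints.

(** * Rank of the general ruled cubic *)

Section Rank.
Variable K : numClosedFieldType.

Lemma sum_of_cubes_seq (f : cubic_form K) (s : seq {mpoly K[4]}) :
  all (fun l => l \is 1.-homog) s ->
  mpoly_of_dhomog f = \sum_(l <- s) l ^+ 3 -> sum_of_cubes f (size s).
Proof.
move=> /all_nthP sh fE; exists (fun i : 'I_(size s) => DHomog (sh 0 i (ltn_ord i))).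
by rewrite fE (big_nth 0) big_mkord.
Qed.

(** From (m + l)^3 + (m - l)^3 - 2 m^3 = 6 l^2 m, with cube roots absorbing the
    scalars. *)
Lemma sqrM_cubes (l m : {mpoly K[4]}) : exists a b : K,
  l ^+ 2 * m = (a%:MP * (m + l)) ^+ 3 + (a%:MP * (m - l)) ^+ 3 + (b%:MP * m) ^+ 3.
Proof.
exists (3.-root 6^-1), (3.-root (- 3^-1)); rewrite !exprMn -!rmorphXn /= !rootCK //.
have C6 : 6%:R * 6^-1%:MP = 1 :> {mpoly K[4]}.
  by rewrite -mpolyC_nat -mpolyCM divff ?mpolyC1 // pnatr_eq0.
have C3 : (- 3^-1)%:MP = - (2%:R * 6^-1%:MP) :> {mpoly K[4]}.
  by rewrite -mpolyC_nat -mpolyCM mpolyCN; congr (- (_%:MP)); field.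
rewrite C3; set c := 6^-1%:MP in C6 *.
by rewrite -[LHS]mul1r -[X in X * _ = _]C6; ring.
Qed.

Lemma six_cubes (f : cubic_form K) :
  two_squares (mpoly_of_dhomog f) -> sum_of_cubes f 6.
Proof.
case=> l1 [l2 [m1 [m2 [[l1h l2h m1h m2h] fE]]]].
have [a [b ab]] := sqrM_cubes l1 m1; have [c [d cd]] := sqrM_cubes l2 m2.
apply: (@sum_of_cubes_seq f [:: a%:MP * (m1 + l1); a%:MP * (m1 - l1); b%:MP * m1;
  c%:MP * (m2 + l2); c%:MP * (m2 - l2); d%:MP * m2]).
  by apply/allP => l; rewrite !inE => /or4P[|||/or3P[]] /eqP ->;
    apply: homogC; rewrite ?rpredB ?rpredD.
by rewrite fE ab cd !big_cons big_nil addr0 !addrA.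
Qed.

Lemma polar_sum_cubes s (l : 'I_s -> {mpoly K[4]}) i j k :
  (forall t, l t \is 1.-homog) -> polar (\sum_t l t ^+ 3) i j k =
  (\sum_t (l t)@_U_(i) * (l t)@_U_(j) * (l t)@_U_(k)) *+ 6.
Proof.
move=> lh; rewrite -sumrMnl /polar.
have dS (F : 'I_s -> {mpoly K[4]}) a : (\sum_t F t)^`M(a) = \sum_t (F t)^`M(a).
  exact: raddf_sum.
rewrite !dS [LHS]raddf_sum /=; apply: eq_bigr => t _.
have l0 : (l t).@[fun=> 0] = 0.
  rewrite [l t]linear_formE // raddf_sum big1 // => m _ /=.
  by rewrite mevalZ mevalXU mulr0.
rewrite !exprS expr0 mulr1 !(mderivD, mderivM, mderiv_linear _ (lh t), mderivC).
by rewrite !(mevalD, mevalM, mevalC, l0, meval0); ring.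
Qed.

(** A is the matrix of the coefficients of the linear forms; it has rank 4, so
    its left kernel is at most a line when s < 6.  The vectors r i j of the
    products of its columns i and j lie in that kernel whenever the derivative
    of whitney in the directions i and j vanishes. *)
Lemma whitney_cubes_ge s (l : 'I_s -> {mpoly K[4]}) :
  (forall t, l t \is 1.-homog) -> whitney K = \sum_t l t ^+ 3 -> (6 <= s)%N.
Proof.
move=> lh wE; rewrite leqNgt; apply/negP => lts.
pose A : 'M[K]_(s, 4) := \matrix_(t, i) (l t)@_U_(i).
have polA i j k : (\sum_t A t i * A t j * A t k) *+ 6 = whitney_polar 1%:M i j k.
  rewrite -polar_whitney lin_subst1 wE polar_sum_cubes //; congr (_ *+ 6).
  by apply: eq_bigr => t _; rewrite !mxE.
have rkA : \rank A = 4.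
  apply/eqP; rewrite eqn_leq rank_leq_col leqNgt -mxrank_tr; apply/negP.
  move=> /left_kernel_vector[u /negP u0 uA]; apply: u0.
  have uE i j : \sum_k u 0 k * whitney_polar 1%:M i j k = 0.
    under eq_bigr => k _ do rewrite -polA mulrnAr mulr_sumr.
    rewrite sumrMnl exchange_big big1 ?mul0rn //= => t _.
    under eq_bigr => k _ do rewrite mulrCA.
    rewrite -mulr_sumr [X in _ * X](_ : _ = 0) ?mulr0 //.
    have /rowP/(_ t) := uA; rewrite !mxE => uAt; rewrite -[RHS]uAt.
    by apply: eq_bigr => k _; rewrite [A^T _ _]mxE.
  have two (y : K) : y *+ 2 = 0 -> y = 0 by move/eqP; rewrite mulrn_eq0 => /eqP.
  apply/eqP/rowP; apply: ord4P; rewrite mxE; apply: two.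
  - by have := uE i0 i2; rewrite sum4 /whitney_polar !mxE /= => <-; ring.
  - by have := uE i1 i3; rewrite sum4 /whitney_polar !mxE /= => <-; ring.
  - by have := uE i0 i0; rewrite sum4 /whitney_polar !mxE /= => <-; ring.
  - by have := uE i1 i1; rewrite sum4 /whitney_polar !mxE /= => <-; ring.
have ker1 : (\rank (kermx A) <= 1)%N by rewrite mxrank_ker rkA; lia.
pose r i j : 'rV[K]_s := \row_t (A t i * A t j).
have rE i j t : r i j 0 t = A t i * A t j by rewrite [LHS]mxE.
clearbody r; clearbody A.
have rker i j : (forall k, whitney_polar (1%:M : 'M[K]_4) i j k = 0) -> (r i j <= kermx A)%MS.
  move=> w0; apply/sub_kermxP/rowP => k; rewrite !mxE.
  have := w0 k; rewrite -polA => /eqP; rewrite mulrn_eq0 => /eqP w0k.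
  rewrite -[RHS]w0k; apply: eq_bigr => t _.
  by rewrite rE.
have Vnz (y : K) : y = 2 -> y != 0 by move=> ->; rewrite pnatr_eq0.
have r22 : r i2 i2 != 0.
  apply/eqP => r0; have /eqP := polA i0 i0 i2; apply/negP; rewrite eq_sym.
  rewrite big1 ?mul0rn => [|t _]; first by apply: Vnz; rewrite /whitney_polar !mxE /=; ring.
  have /rowP/(_ t) := r0; rewrite rE mxE => /eqP; rewrite mulf_eq0 orbb => /eqP ->.
  by rewrite mulr0.
have multiple i j : (forall k, whitney_polar (1%:M : 'M[K]_4) i j k = 0) ->
    exists c, r i j = c *: r i2 i2.
  move=> w0; apply/sub_rVP; apply: submx_trans (rker _ _ w0) _.
  have w22 k : whitney_polar (1%:M : 'M[K]_4) i2 i2 k = 0.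
    by move: k; apply: ord4P; rewrite /whitney_polar !mxE /=; ring.
  have rk22 : \rank (r i2 i2) = 1%N by rewrite rank_rV r22.
  by rewrite -(mxrank_leqif_sup (rker _ _ w22)) rk22 eqn_leq ker1 -{1}rk22 mxrankS ?rker.
have [c c23] : exists c, r i2 i3 = c *: r i2 i2.
  by apply: multiple; apply: ord4P; rewrite /whitney_polar !mxE /=; ring.
have [d d33] : exists c, r i3 i3 = c *: r i2 i2.
  by apply: multiple; apply: ord4P; rewrite /whitney_polar !mxE /=; ring.
(* r_23 = c r_22 gives this where A t i2 <> 0, and r_33 = d r_22 where A t i2 = 0 *)
have A3 t : A t i3 = c * A t i2.
  have /rowP/(_ t) := c23; have /rowP/(_ t) := d33; rewrite !mxE !rE.
  have [->|At2] := eqVneq (A t i2) 0.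
    by rewrite !mulr0 => /eqP; rewrite mulf_eq0 orbb => /eqP.
  by move=> _ /eqP; rewrite mulrCA (inj_eq (mulfI At2)) => /eqP.
have := polA i1 i1 i3; apply/eqP; rewrite eq_sym.
have -> : (\sum_t A t i1 * A t i1 * A t i3) *+ 6 = c * whitney_polar 1%:M i1 i1 i2.
  rewrite -polA mulrnAr mulr_sumr; congr (_ *+ 6); apply: eq_bigr => t _.
  by rewrite A3; ring.
rewrite [X in c * X](_ : _ = 0) ?mulr0; last by rewrite /whitney_polar !mxE /=; ring.
by apply: Vnz; rewrite /whitney_polar !mxE /=; ring.
Qed.

Lemma has_rank_whitney (f : cubic_form K) (g : 'M[K]_4) : g \in unitmx ->
  mpoly_of_dhomog f = whitney K \mPo lin_subst g -> has_rank f 6.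
Proof.
move=> gU fE; split.
  apply: six_cubes; rewrite fE whitney_lin_subst.
  by do 4!eexists; split; last by []; split; apply: lin_subst_homog.
move=> s [l lE].
apply: (@whitney_cubes_ge s (fun t => mpoly_of_dhomog (l t) \mPo lin_subst (invmx g))).
  by move=> t; apply/dhomog_lin_subst/dhomog_is_dhomog.
rewrite -[LHS]lin_subst1 -(mulmxV gU) -lin_subst_comp -fE lE raddf_sum.
by apply: eq_bigr => t _; rewrite /= rmorphXn.
Qed.

End Rank.

(** * The highest orbit *)

Section Main.
Variable K : numClosedFieldType.

Definition whitney_cubic : cubic_form K := DHomog (whitney_subst_homog (1%:M : 'M[K]_4)).

Lemma whitney_cubicE : mpoly_of_dhomog whitney_cubic = whitney K.
Proof. exact: lin_subst1. Qed.

Lemma whitney_cubic_neq0 : whitney_cubic != 0.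
Proof.
apply/eqP => /(congr1 (fun f : cubic_form K => (mpoly_of_dhomog f).@[fun=> 1])).
rewrite whitney_cubicE /whitney rmorph0 !(rmorphD, rmorphM, rmorphXn) /= !mevalXU.
by move/eqP; rewrite !mulr1 -mulr2n pnatr_eq0.
Qed.

(** The whole line x = y = 0 is singular. *)
Lemma whitney_infinitely_singular : infinite_set (singular_points whitney_cubic).
Proof.
pose v (n : nat) : 'rV[K]_4 := delta_mx 0 i2 + n%:R *: delta_mx 0 i3.
have v2 n : v n 0 i2 = 1 by rewrite !mxE /= mulr0 addr0.
have v3 n : v n 0 i3 = n%:R by rewrite !mxE /= mulr1 add0r.
have v0 n : v n != 0 by apply/rV0Pn; exists i2; rewrite v2 oner_eq0.
have vS n : singular_points whitney_cubic <[v n]>%VS.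
  split; first by rewrite dim_vline v0.
  move=> w /vlineP[c ->] i; rewrite whitney_cubicE /whitney !expr2.
  rewrite !(mderivD, mderivM, mderivXU) !(mevalD, mevalM, mevalXU, rmorph_nat).
  have -> : (c *: v n) 0 i0 = 0 by rewrite !mxE /= !mulr0 addr0 mulr0.
  have -> : (c *: v n) 0 i1 = 0 by rewrite !mxE /= !mulr0 addr0 mulr0.
  ring.
have v_inj : injective (fun n => <[v n]>%VS).
  move=> m n mn; have /vlineP[c cE] : v m \in <[v n]>%VS by rewrite -mn memv_line.
  have := congr1 (fun w : 'rV[K]_4 => w 0 i2) cE; rewrite /= v2 [RHS]mxE v2 mulr1 => c1.
  have := congr1 (fun w : 'rV[K]_4 => w 0 i3) cE; rewrite /= v3 [RHS]mxE v3 -c1 mul1r.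
  by move/eqP; rewrite eqr_nat => /eqP.
have rangeS : (range (fun n => <[v n]>%VS) `<=` singular_points whitney_cubic)%classic.
  by move=> _ [n _ <-].
apply: sub_infinite_set rangeS _; apply/infiniteP.
by rewrite (card_le_eqr (inj_card_eq (in2W v_inj))) card_lexx.
Qed.

Lemma highest_orbit_rank (O : set (cubic_form K)) :
  highest_dim_infinitely_singular_orbit O -> forall f, O f -> has_rank f 6.
Proof.
move=> [[f0 [f00 f0S ->]] max] f [g gU fE].
have dimO : (14 <= variety_dim (GL4_orbit f0))%N.
  apply: leq_trans (variety_dim_whitney whitney_cubicE) (max _ _).
  exists whitney_cubic; split=> //; [exact: whitney_cubic_neq0|].
  exact: whitney_infinitely_singular.
have not_plane : ~ has_plane (mpoly_of_dhomog f0).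
  move=> f0p; suff : (14 <= 13)%N by [].
  by apply: leq_trans dimO (variety_dim_plane _) => h [k _ ->]; apply: has_plane_subst.
have not_pinched : ~ pinched (mpoly_of_dhomog f0).
  move=> f0p; suff : (14 <= 13)%N by [].
  by apply: leq_trans dimO (variety_dim_pinched _) => h [k _ ->]; apply: pinched_subst.
have [//|/has_double_line_cases[//|]] := infinitely_singular_cases f0S.
case/two_squares_cases => [//|[k kU f0E]].
apply: (@has_rank_whitney _ _ (k *m g)); first by rewrite unitmx_mul kU.
by rewrite fE f0E lin_subst_comp.
Qed.
End Main.

Theorem corollary3p4 (R : realType) (O : set (cubic_form R[i]))
    (hO : highest_dim_infinitely_singular_orbit O)
    (f : cubic_form R[i]) (hf : O f) : has_rank f 6.
Proof.
exact: (@highest_orbit_rank R[i] O hO f hf).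
Qed.
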